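(* Let $C_*=2/(1-\log 2)$ and suppose $p=p(n)$ satisfies $C_*\log n/n\le p$ and $p=o(n^{-1/2})$. Let $G\sim G(n,p)$. Then for every fixed $\varepsilon$ with $0<\varepsilon<1/2$ and all integers $d=d(n)$, as $n\to\infty$, \[ \mathbb P(G\text{ is }d\text{-rigid})\to\begin{cases}1 & \text{if } d<(1/2-\varepsilon)np,\\ 0 & \text{if } d>(1/2+\varepsilon)np.\end{cases} \]
   Context: $G(n,p)$ is the Erdős–Rényi random graph on vertex set $[n]$ with each edge present independently with probability $p$; $\log$ is the natural logarithm. For a graph $G=(V,E)$ and integer $d\ge1$, an embedding $\mathbf p:V\to\mathbb R^d$ is generic if its $d|V|$ coordinates are algebraically independent over $\mathbb Q$. The rigidity matrix $R(G,\mathbf p)$ is the $|E|\times d|V|$ matrix whose row indexed by $xy\in E$ contains $(\mathbf p(x)-\mathbf p(y))^T$ in the coordinates of $x$, $(\mathbf p(y)-\mathbf p(x))^T$ in the coordinates of $y$, and $0$ elsewhere. A graph with $|V|>d$ is $d$-rigid if for a generic $\mathbf p$, $\operatorname{rank}R(G,\mathbf p)=d|V|-\binom{d+1}{2}$ (independent of the choice of generic $\mathbf p$). *)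

(* Defs.v *)
From HB Require Import structures.
From mathcomp Require Import all_boot all_order all_algebra.
From mathcomp Require Import mpoly.
From mathcomp Require Import boolp classical_sets reals topology normedtype sequences exp.

Set Implicit Arguments.
Unset Strict Implicit.
Unset Printing Implicit Defensive.

Import Order.TTheory GRing.Theory Num.Theory.
Local Open Scope ring_scope.

(* A simple graph on vertex set [n] = 'I_n is a set of pairs (x,y) with x < y
   (each unordered edge {x,y} stored once, with its smaller endpoint first). *)
Definition all_pairs (n : nat) : {set 'I_n * 'I_n} :=
  [set u : 'I_n * 'I_n | (u.1 < u.2)%N].

(* Embedding p : V -> R^d, as an n x d matrix whose x-th row is p(x). *)
Definition generic (R : realType) (n d : nat) (P : 'M[R]_(n, d)) : Prop :=
  forall q : {mpoly rat[n * d]}, q != 0 ->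
    (map_mpoly (ratr : rat -> R) q).@[fun i => mxvec P 0 i] != 0.

Definition rigidity_matrix (R : realType) (n d : nat)
    (E : {set 'I_n * 'I_n}) (P : 'M[R]_(n, d)) : 'M[R]_(#|E|, n * d) :=
  \matrix_(i < #|E|)
    mxvec (\matrix_(v < n, k < d)
      (let u := enum_val i in
       if v == u.1 then P u.1 k - P u.2 k
       else if v == u.2 then P u.2 k - P u.1 k else 0)).

Definition d_rigid (R : realType) (d n : nat) (E : {set 'I_n * 'I_n}) : Prop :=
  (d < n)%N /\
  forall P : 'M[R]_(n, d), generic P ->
    \rank (rigidity_matrix E P) = (d * n - 'C(d.+1, 2))%N.

Definition Gnp_prob (R : realType) (n : nat) (p : R)
    (Q : {set 'I_n * 'I_n} -> Prop) : R :=
  \sum_(E in powerset (all_pairs n))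
     p ^+ #|E| * (1 - p) ^+ (#|all_pairs n| - #|E|) *
     (if `[< Q E >] then 1 else 0).

(* Main.v *)
(* Fix a generic embedding and call a pair of vertices spanned if its row lies
   in the row space of the edges of G.  The spanned pairs form a closed graph in
   the generic rigidity matroid; G is rigid as soon as all pairs are spanned.

   Structure of closed graphs.  Add the vertices one at a time in a random
   order.  By 0-extension a new vertex with at least d earlier neighbours raises
   the rank by at least d, and by 1-extension it raises it by more than d unless
   its earlier neighbours form a clique.  As the rank is at most dn, and few
   vertices have fewer than d earlier neighbours, the earlier neighbours of
   almost every vertex form a clique.  As d^2 = o(n), this bounds almost all
   degrees by a + o(n), where a is the largest size of a clique, so that there
   are at most (a + o(n)) n / 2 spanned pairs.

   A large clique.  Let W be spanned by the rows of all pairs in a vertex set A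
   of size a.  Exposing the edges of G one at a time, the rank over W grows with
   probability p at each pair outside the current span.  Since the rank can only
   grow by d (n - a) < (1 / 2 - eps) n p (n - a), an exponential moment bound
   gives more than (a + o(n)) n / 2 spanned pairs over W, with an error
   probability exp (- c n^2 p) that survives a union bound over all A with
   n - a >= eta n.  Hence a largest clique misses fewer than eta n vertices.

   The end.  For p >= C_* log n / n all degrees exceed (1 / 2 - eps / 2) n p.  A
   vertex outside a largest clique has fewer than d neighbours in it, hence more
   than eps n p / 2 neighbours outside, and a set of fewer than eta n vertices is
   too sparse for that.

   In the other direction G has fewer edges than the required rank. *)
Require Import Defs.
From HB Require Import structures.
From mathcomp Require Import all_boot all_order all_algebra.
From mathcomp Require Import mpoly ring lra zify perm.
From mathcomp Require Import classical_sets boolp cardinality set_interval.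
From mathcomp Require Import reals topology normedtype sequences exp.
From mathcomp Require Import lebesgue_measure.
(* fintype and finset again, so that set0, subsetP, ... denote finite sets *)
From mathcomp Require Import fintype finset.

Set Implicit Arguments.
Unset Strict Implicit.
Unset Printing Implicit Defensive.
Import Order.TTheory GRing.Theory Num.Theory numFieldNormedType.Exports.
Local Open Scope ring_scope.

(** * Generic rank and extensions *)

(** Choosing a maximal free set of rows, then of columns, certifies the rank by a single nonzero
    minor. This is a polynomial inequation, the form to which algebraic independence applies. *)
Lemma mxrank_minor (F : fieldType) (m q : nat) (A : 'M[F]_(m, q)) :
  exists r (f : 'I_r -> 'I_m) (g : 'I_r -> 'I_q),
    r = \rank A /\ \det (mxsub f g A) != 0.
Proof.
set B := rowsub (maxrankfun A) A.
have rB : \rank B^T = \rank A by rewrite mxrank_tr; apply/eqP/maxrowsub_free.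
have castfree a b (e : a = b) (M : 'M[F]_(a, b)) :
    row_free M -> row_free (colsub (cast_ord e) M).
  case: _ / e M => M; rewrite (_ : colsub _ M = M) //.
  by apply/matrixP=> i j; rewrite !mxE; congr (M _ _); apply/val_inj.
exists (\rank B^T), (maxrankfun A \o cast_ord rB), (maxrankfun B^T).
split=> //.
rewrite (_ : mxsub _ _ A =
  (colsub (cast_ord rB) (rowsub (maxrankfun B^T) B^T))^T); last first.
  by apply/matrixP=> i j; rewrite !mxE.
rewrite det_tr -unitfE -unitmxE -row_free_unit.
exact/castfree/maxrowsub_free.
Qed.

Lemma mxrank_mxsub (F : fieldType) (m q r s : nat) (f : 'I_r -> 'I_m)
    (g : 'I_s -> 'I_q) (A : 'M[F]_(m, q)) :
  (\rank (mxsub f g A) <= \rank A)%N.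
Proof.
have rsub a b c (h : 'I_c -> 'I_a) (M : 'M[F]_(a, b)) :
    (\rank (rowsub h M) <= \rank M)%N.
  by apply/mxrankS/row_subP=> i; rewrite row_rowsub row_sub.
rewrite (_ : mxsub f g A = rowsub f (rowsub g A^T)^T); last first.
  by apply/matrixP=> i j; rewrite !mxE.
by apply: leq_trans (rsub _ _ _ _ _) _; rewrite mxrank_tr -(mxrank_tr A).
Qed.

(** Rank-nullity for multiplication by [Q] on the sum: the image contains that of [B], and the
    kernel contains [A]. *)
Lemma mxrank_adds_mulr (F : fieldType) (m1 m2 q t : nat) (A : 'M[F]_(m1, q))
    (B : 'M[F]_(m2, q)) (Q : 'M[F]_(q, t)) :
  A *m Q = 0 -> (\rank A + \rank (B *m Q)%R <= \rank (A + B)%MS)%N.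
Proof.
move=> AQ0; rewrite -(mxrank_mul_ker (A + B)%MS Q) addnC leq_add //.
  by apply/mxrankS/submxMr/addsmxSr.
by apply/mxrankS; rewrite sub_capmx addsmxSl; apply/sub_kermxP.
Qed.

Section Transfer.
Variables (F : numFieldType) (N : nat).
Implicit Types x : 'I_N -> F.

Definition alg_indep x : Prop := forall q : {mpoly rat[N]},
  q != 0 -> (map_mpoly (ratr : rat -> F) q).@[x] != 0.

Definition rat_eval x : {rmorphism {mpoly rat[N]} -> F} :=
  meval x \o map_mpoly (ratr : rat -> F).

(* A nonzero minor at one point is a nonzero polynomial, so it does not vanish
   at an algebraically independent point. *)
Lemma mxrank_transfer (m q : nat) (A : 'M[{mpoly rat[N]}]_(m, q)) x0 x :
  alg_indep x ->
  (\rank (map_mx (rat_eval x0) A) <= \rank (map_mx (rat_eval x) A))%N.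
Proof.
move=> x_indep.
have [r [f [g [<- det0]]]] := mxrank_minor (map_mx (rat_eval x0) A).
have detE y : \det (mxsub f g (map_mx (rat_eval y) A)) =
    rat_eval y (\det (mxsub f g A)).
  by rewrite -det_map_mx; congr (\det _); apply/matrixP=> i j; rewrite !mxE.
have : \det (mxsub f g (map_mx (rat_eval x) A)) != 0.
  rewrite detE; apply: x_indep; apply: contraNneq det0 => det0.
  by rewrite detE det0 rmorph0.
rewrite -unitfE -unitmxE -row_free_unit => /eqP rk.
by rewrite -[leqLHS]rk mxrank_mxsub.
Qed.

End Transfer.

Section EdgeRows.
Variables (n d : nat).

(** Written without case distinction, so that it is symmetric in [x] and [y], vanishes when they
    coincide, and commutes with ring morphisms. *)
Definition edge_row (K : pzRingType) (P : 'M[K]_(n, d)) (x y : 'I_n) :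
    'rV[K]_(n * d) :=
  mxvec (\matrix_(v, k) (((v == x)%:R - (v == y)%:R) * (P x k - P y k))).

Lemma edge_rowC (K : pzRingType) (P : 'M[K]_(n, d)) x y :
  edge_row P x y = edge_row P y x.
Proof.
congr mxvec; apply/matrixP=> v k; rewrite !mxE.
by rewrite -[X in X * _]opprB -[X in _ * X]opprB mulrNN.
Qed.

Lemma edge_rowxx (K : pzRingType) (P : 'M[K]_(n, d)) x : edge_row P x x = 0.
Proof.
by apply/eqP; rewrite mxvec_eq0; apply/eqP/matrixP=> v k; rewrite !mxE subrr mul0r.
Qed.

(** The universal embedding, with indeterminates as coordinates; every embedding is a specialization
    of it. *)
Definition generic_mx : 'M[{mpoly rat[n * d]}]_(n, d) :=
  vec_mx (\row_i 'X_i).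

Lemma map_generic_mx (F : numFieldType) (P : 'M[F]_(n, d)) :
  map_mx (rat_eval (fun i => mxvec P 0 i)) generic_mx = P.
Proof.
rewrite map_vec_mx -[RHS]mxvecK; congr vec_mx; apply/rowP=> i.
by rewrite !mxE /= map_mpolyX mevalXU.
Qed.

Lemma map_edge_row (K L : pzRingType) (f : {rmorphism K -> L})
    (P : 'M[K]_(n, d)) x y :
  map_mx f (edge_row P x y) = edge_row (map_mx f P) x y.
Proof.
rewrite map_mxvec; congr mxvec; apply/matrixP=> v k.
by rewrite !mxE rmorphM !rmorphB !rmorph_nat.
Qed.

End EdgeRows.

Section Rigidity.
Variables (F : numFieldType) (n d : nat).
Implicit Types (P : 'M[F]_(n, d)) (E : {set 'I_n * 'I_n}).
Implicit Types (S N : {set 'I_n}) (x y v : 'I_n).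

Definition generic_pts P := alg_indep (fun i => mxvec P 0 i).

Definition edge_span P E : 'M[F]_(n * d) :=
  (\sum_(u in E) <<edge_row P u.1 u.2>>)%MS.

Lemma edge_row_sub P E u : u \in E -> (edge_row P u.1 u.2 <= edge_span P E)%MS.
Proof. by move=> uE; rewrite (sumsmx_sup u) ?genmxE. Qed.

Lemma edge_span_subP P E m (M : 'M[F]_(m, n * d)) :
  reflect (forall u, u \in E -> (edge_row P u.1 u.2 <= M)%MS)
          (edge_span P E <= M)%MS.
Proof.
apply: (iffP sumsmx_subP) => EM u uE; have := EM u uE; rewrite genmxE //.
Qed.

Lemma edge_spanS P E1 E2 : E1 \subset E2 -> (edge_span P E1 <= edge_span P E2)%MS.
Proof.
by move=> /subsetP s12; apply/edge_span_subP=> u /s12; apply: edge_row_sub.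
Qed.

Lemma edge_spanU P E1 E2 :
  (edge_span P (E1 :|: E2) :=: edge_span P E1 + edge_span P E2)%MS.
Proof.
apply/eqmxP/andP; split; last first.
  by rewrite addsmx_sub !edge_spanS ?subsetUl ?subsetUr.
apply/edge_span_subP=> u; rewrite inE => /orP[] /(edge_row_sub P) uE.
  exact: submx_trans uE (addsmxSl _ _).
exact: submx_trans uE (addsmxSr _ _).
Qed.

(** Unlike [edge_span], this makes sense over a polynomial ring, as [mxrank_transfer] requires. *)
Definition edge_mx (K : pzRingType) (P : 'M[K]_(n, d)) E : 'M[K]_(#|E|, n * d) :=
  \matrix_(i < #|E|) edge_row P (enum_val i).1 (enum_val i).2.

Lemma edge_mxE P E : (edge_mx P E :=: edge_span P E)%MS.
Proof.
apply/eqmxP/andP; split.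
  by apply/row_subP=> i; rewrite rowK; apply/edge_row_sub/enum_valP.
apply/edge_span_subP=> u uE.
rewrite -(enum_rankK_in uE uE).
by rewrite -(rowK (fun i => edge_row P (enum_val i).1 (enum_val i).2)) row_sub.
Qed.

Lemma edge_span_transfer P0 P E :
  generic_pts P -> (\rank (edge_span P0 E) <= \rank (edge_span P E))%N.
Proof.
move=> genP; rewrite -!edge_mxE.
have E0 (Q : 'M[F]_(n, d)) : edge_mx Q E =
    map_mx (rat_eval (fun i => mxvec Q 0 i)) (edge_mx (generic_mx n d) E).
  apply/row_matrixP=> i.
  by rewrite rowK -map_row rowK map_edge_row map_generic_mx.
by rewrite (E0 P0) (E0 P) mxrank_transfer.
Qed.

Definition star_dirs P v N : 'M[F]_d :=
  (\sum_(u in N) <<row v P - row u P>>)%MS.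

Lemma star_rank P v N : generic_pts P -> v \notin N ->
  (minn d #|N| <= \rank (star_dirs P v N))%N.
Proof.
move=> genP vN; set m := minn d #|N|.
have m_d : (m <= d)%N := geq_minl _ _; have m_N : (m <= #|N|)%N := geq_minr _ _.
pose f (i : 'I_m) := enum_val (widen_ord m_N i).
have f_inj : injective f.
  by move=> i j /enum_val_inj /(congr1 val) /= /val_inj.
have fv i : (f i == v) = false.
  by apply: contraNF vN => /eqP <-; apply: enum_valP.
pose A (K : pzRingType) (Q : 'M[K]_(n, d)) : 'M[K]_(m, d) :=
  \matrix_(i, k) (Q v k - Q (f i) k).
have AE (Q : 'M[F]_(n, d)) :
    A F Q = map_mx (rat_eval (fun i => mxvec Q 0 i)) (A _ (generic_mx n d)).
  apply/matrixP=> i k; rewrite !mxE rmorphB /=.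
  by rewrite -[in LHS](map_generic_mx Q) !mxE.
have <- : \rank (pid_mx m : 'M[F]_(m, d)) = m by rewrite rank_pid_mx.
(* Special position: [v] at the origin and the [i]-th chosen neighbour at minus the [i]-th basis
   vector, so that the differences form [pid_mx m]. *)
pose P0 : 'M[F]_(n, d) :=
  \matrix_(w, k) - ([exists i, (f i == w) && (i == k :> nat)])%:R.
have <- : A F P0 = pid_mx m.
  apply/matrixP=> i k; rewrite !mxE ltn_ord andbT.
  have -> : [exists i0, (f i0 == v) && (i0 == k :> nat)] = false.
    by apply/existsP=> -[j]; rewrite fv.
  rewrite oppr0 sub0r opprK; congr (_%:R); congr nat_of_bool.
  apply/existsP/idP => [[j /andP[/eqP/f_inj -> //]]|ik].
  by exists i; rewrite eqxx.
rewrite (AE P0) (leq_trans (mxrank_transfer _ _ genP)) // -AE.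
apply/mxrankS/row_subP=> i.
have -> : row i (A F P) = row v P - row (f i) P by apply/rowP=> k; rewrite !mxE.
by rewrite (sumsmx_sup (f i)) ?genmxE ?enum_valP.
Qed.

Definition vertex_proj v : 'M[F]_(n * d, d) := lin1_mx (row v \o vec_mx).

Lemma edge_row_proj P x y v :
  edge_row P x y *m vertex_proj v =
  ((v == x)%:R - (v == y)%:R) *: (row x P - row y P).
Proof.
by rewrite mul_rV_lin1 /= mxvecK; apply/rowP=> k; rewrite !mxE.
Qed.

Definition star v N : {set 'I_n * 'I_n} := [set (v, u) | u in N].

Lemma star_proj P v N : v \notin N ->
  (edge_span P (star v N) *m vertex_proj v :=: star_dirs P v N)%MS.
Proof.
move=> vN; apply/eqmxP.
have dir u : u \in N ->
    edge_row P v u *m vertex_proj v = row v P - row u P.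
  move=> uN; rewrite edge_row_proj eqxx (_ : (v == u) = false) ?subr0 ?scale1r //.
  by apply: contraNF vN => /eqP ->.
rewrite /edge_span sumsmxMr_gen; apply/andP; split; apply/sumsmx_subP=> u.
  move=> /imsetP[w wN ->] /=; rewrite genmxE (eqmxMr _ (genmxE _)) dir //.
  by rewrite (sumsmx_sup w) ?genmxE.
move=> uN; rewrite genmxE sumsmxMr_gen (sumsmx_sup (v, u)) ?imset_f //=.
by rewrite genmxE (eqmxMr _ (genmxE _)) dir.
Qed.

Definition edges_in S E := forall u, u \in E -> (u.1 \in S) && (u.2 \in S).

Lemma edge_span_proj0 P S E v :
  edges_in S E -> v \notin S -> edge_span P E *m vertex_proj v = 0.
Proof.
move=> ES vS; apply/sub_kermxP/edge_span_subP=> u /ES /andP[u1 u2].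
apply/sub_kermxP; rewrite edge_row_proj.
by rewrite !(negPf (memPnC vS _ _)) ?subrr ?scale0r.
Qed.

(** Projection to the coordinates of [v] kills the old rows and sends the new ones to the directions
    from [v] to [N]. *)
Lemma zero_extension P S E v N : generic_pts P -> edges_in S E -> v \notin S ->
  N \subset S ->
  (\rank (edge_span P E) + minn d #|N| <= \rank (edge_span P (E :|: star v N)))%N.
Proof.
move=> genP ES vS /subsetP NS; rewrite edge_spanU.
have vN : v \notin N by apply: contra vS; apply: NS.
apply: leq_trans (mxrank_adds_mulr _ (edge_span_proj0 P ES vS)).
by rewrite leq_add2l star_proj // star_rank.
Qed.

(** By [edge_span_transfer] one special position of [v] suffices. There the star of [v] spans the
    missing row of [x y], which gives the extra unit of rank, and still has [d] independent
    directions at [v]. *)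
Lemma one_extension P S E v N x y :
  generic_pts P -> edges_in S E -> v \notin S -> N \subset S ->
  (d < #|N|)%N -> x \in N -> y \in N ->
  ~~ (edge_row P x y <= edge_span P E)%MS ->
  (\rank (edge_span P E) + d < \rank (edge_span P (E :|: star v N)))%N.
Proof.
move=> genP ES vS NS dN xN yN nxy.
have vN : v \notin N by apply: contra vS; apply: (subsetP NS).
have vneq u : u \in S -> (u == v) = false.
  by move=> uS; apply: contraNF vS => /eqP <-.
have [xS yS] := (subsetP NS _ xN, subsetP NS _ yN).
have nxy' : x != y.
  by apply: contra nxy => /eqP ->; rewrite edge_rowxx sub0mx.
(* v is moved to the midpoint of x y, where the rows of v x and v y add up to
   half of the row of x y *)
pose P0 : 'M[F]_(n, d) :=
  \matrix_(w, k) (if w == v then (P x k + P y k) / 2%:R else P w k).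
have P0S w k : w \in S -> P0 w k = P w k by move=> wS; rewrite !mxE vneq.
have erS w z : w \in S -> z \in S -> edge_row P0 w z = edge_row P w z.
  by move=> wS zS; congr mxvec; apply/matrixP=> i k; rewrite [LHS]mxE [RHS]mxE !P0S.
have two0 : (2%:R : F) != 0 by rewrite pnatr_eq0.
have P0v k : P0 v k = (P x k + P y k) / 2%:R by rewrite mxE eqxx.
have mid : edge_row P x y = 2%:R *: (edge_row P0 v x + edge_row P0 v y).
  have coordE (Q : 'M[F]_(n, d)) a b w k : vec_mx (edge_row Q a b) w k =
      ((w == a)%:R - (w == b)%:R) * (Q a k - Q b k) by rewrite mxvecK mxE.
  apply: (can_inj vec_mxK); apply/matrixP=> w k.
  rewrite linearZ linearD /= [LHS]coordE [RHS]mxE [in RHS]mxE !coordE.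
  by rewrite !P0v !P0S //; field.
have spanE : edge_span P0 E = edge_span P E.
  by apply: eq_bigr => u /ES /andP[u1 u2]; rewrite erS.
apply: leq_trans (edge_span_transfer P0 _ genP); rewrite edge_spanU spanE.
pose A := (edge_span P E + <<edge_row P x y>>)%MS.
have A0 : A *m vertex_proj v = 0.
  apply/sub_kermxP; rewrite addsmx_sub genmxE; apply/andP; split.
    by apply/sub_kermxP/(edge_span_proj0 P ES vS).
  by apply/sub_kermxP; rewrite edge_row_proj ![v == _]eq_sym !vneq ?subrr ?scale0r.
have rA : (\rank (edge_span P E) < \rank A)%N.
  rewrite ltn_neqAle mxrankS ?addsmxSl // andbT.
  apply: contra nxy => /eqP rE.
  apply: submx_trans (_ : (A <= _)%MS); first by rewrite -genmxE addsmxSr.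
  by rewrite -(geq_leqif (mxrank_leqif_sup (addsmxSl _ _))) rE.
have starA : (A + edge_span P0 (star v N) <= edge_span P E + edge_span P0 (star v N))%MS.
  rewrite !addsmx_sub addsmxSl addsmxSr genmxE mid scalemx_sub // addmx_sub //=.
    by apply: submx_trans (addsmxSr _ _); apply: (@edge_row_sub P0 _ (v, x));
      rewrite imset_f.
  by apply: submx_trans (addsmxSr _ _); apply: (@edge_row_sub P0 _ (v, y));
      rewrite imset_f.
rewrite -addSn; apply: leq_trans (mxrankS starA).
apply: leq_trans (mxrank_adds_mulr (edge_span P0 (star v N)) A0).
rewrite leq_add // star_proj //.
(* [v] is not generic in [P0], but differences of its directions are the directions from [y] to the
   rest of [N], which are generic and at least [d] in number. *)
have yNy : y \notin N :\ y by rewrite !inE eqxx.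
apply: leq_trans (_ : \rank (star_dirs P y (N :\ y)) <= _)%N.
  apply: leq_trans (star_rank genP yNy).
  by rewrite leq_min leqnn /=; move: dN; rewrite (cardsD1 y) yN.
apply/mxrankS/sumsmx_subP=> u; rewrite !inE => /andP[uy uN]; rewrite genmxE.
have dir w : w \in N -> (row v P0 - row w P0 <= star_dirs P0 v N)%MS.
  by move=> wN; rewrite (sumsmx_sup w) ?genmxE.
rewrite (_ : row y P - row u P = (row v P0 - row u P0) - (row v P0 - row y P0)).
  by rewrite addmx_sub ?eqmx_opp ?dir.
by rewrite opprB [RHS]addrC addrA subrK; congr (_ - _); apply/rowP=> k;
  rewrite ![row _ _ _ _]mxE P0S ?(subsetP NS).
Qed.

End Rigidity.

Lemma card_ltn_pairs (m : nat) :
  #|[set u : 'I_m * 'I_m | (u.1 < u.2)%N]| = 'C(m, 2).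
Proof.
rewrite -bin2_sum big_mkord -sum1_card.
rewrite (eq_bigl (fun u : 'I_m * 'I_m => (u.1 < u.2)%N)); last by move=> u; rewrite inE.
rewrite -(pair_big_dep xpredT (fun i j : 'I_m => (i < j)%N) (fun _ _ => 1%N)) /=.
rewrite (exchange_big_dep xpredT) //=; apply: eq_bigr => j _.
have w_inj : injective (widen_ord (ltnW (ltn_ord j))).
  by move=> i k /(congr1 val) /= /val_inj.
rewrite sum1_card -[RHS]card_ord -(card_imset _ w_inj).
apply: eq_card => i; apply/idP/imsetP => [ij|[k _ ->]]; last exact: (ltn_ord k).
by exists (Ordinal (ij : (i < j)%N)); last apply/val_inj.
Qed.

(** * Trivial motions and the maximal rank *)

Section TrivialMotions.
Variables (n d : nat).
Local Notation pairs := [set u : 'I_d.+1 * 'I_d.+1 | (u.1 < u.2)%N].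

Section Ring.
Variable K : pzRingType.
Implicit Type P : 'M[K]_(n, d).

(* Homogeneous coordinates (p, 1) of the point p at vertex v. *)
Definition hcoord P v (j : 'I_d.+1) : K := oapp (P v) 1 (insub (j : nat)).

Lemma hcoord_widen P v (k : 'I_d) : hcoord P v (widen_ord (leqnSn d) k) = P v k.
Proof. by rewrite /hcoord /= valK. Qed.

Lemma hcoord_max P v : hcoord P v ord_max = 1.
Proof. by rewrite /hcoord insubF //= ltnn. Qed.

(* The skew matrix E_ij - E_ji acts on homogeneous coordinates as a rotation if
   j < d and as a translation if j = d. *)
Definition motion P (u : 'I_d.+1 * 'I_d.+1) (v : 'I_n) (k : 'I_d) : K :=
  hcoord P v u.2 * (widen_ord (leqnSn d) k == u.1)%:R -
  hcoord P v u.1 * (widen_ord (leqnSn d) k == u.2)%:R.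

Definition motion_mx P : 'M[K]_(#|pairs|, n * d) :=
  \matrix_(t < #|pairs|) mxvec (\matrix_(v, k) motion P (enum_val t) v k).

End Ring.

Lemma map_motion_mx (K L : pzRingType) (f : {rmorphism K -> L}) (P : 'M[K]_(n, d)) :
  map_mx f (motion_mx P) = motion_mx (map_mx f P).
Proof.
apply/row_matrixP=> t; rewrite -map_row !rowK map_mxvec; congr mxvec.
have hc v j : f (hcoord P v j) = hcoord (map_mx f P) v j.
  by rewrite /hcoord; case: insubP => [k _ _|_] /=; rewrite ?rmorph1 ?mxE.
by apply/matrixP=> v k; rewrite !mxE rmorphB !rmorphM !rmorph_nat /= !hc.
Qed.

Variable F : numFieldType.
Implicit Type P : 'M[F]_(n, d).

Lemma motionE P u v k : motion P u v k =
  hcoord P v u.2 * (widen_ord (leqnSn d) k == u.1)%:R -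
  hcoord P v u.1 * (widen_ord (leqnSn d) k == u.2)%:R :> F.
Proof. by []. Qed.

(** The product is a skew form evaluated twice at the difference [D] of homogeneous coordinates,
    hence zero. As the last coordinate of [D] vanishes, the sum may run over [d.+1] indices. *)
Lemma edge_row_motion P x y t :
  edge_row P x y *m (row t (motion_mx P))^T = 0.
Proof.
rewrite rowK; set u := enum_val t; set A := (X in mxvec X).
have -> : edge_row P x y =
    mxvec ((delta_mx 0 x - delta_mx 0 y : 'rV[F]_n)^T *m (row x P - row y P)).
  congr mxvec; apply/matrixP=> v k; rewrite !mxE big_ord1 !mxE eqxx /=.
  by rewrite ![v == _]eq_sym.
rewrite mxvec_dotmul mulmxBl -!rowE; apply/matrixP=> i j; rewrite !ord1 {i j} !mxE.
pose D j := hcoord P x j - hcoord P y j.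
pose G k := D u.2 * (k == u.1)%:R - D u.1 * (k == u.2)%:R.
transitivity (\sum_(k < d) G (widen_ord (leqnSn d) k) * D (widen_ord (leqnSn d) k)).
  apply: eq_bigr => k _; rewrite /A !mxE /G /D !hcoord_widen !motionE.
  by move: ((_ == u.1)%:R : F) ((_ == u.2)%:R : F) => e1 e2; ring.
transitivity (\sum_(k < d.+1) G k * D k).
  by rewrite big_ord_recr /= [X in _ + _ * X]/D !hcoord_max subrr mulr0 addr0.
transitivity (D u.2 * D u.1 - D u.1 * D u.2); last by rewrite mulrC subrr.
have pick j : \sum_k (k == j)%:R * D k = D j.
  by rewrite (bigD1 j) //= eqxx mul1r big1 ?addr0 // => k /negPf ->; rewrite mul0r.
rewrite -{1}(pick u.1) -{2}(pick u.2) !mulr_sumr -sumrB.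
apply: eq_bigr => k _; rewrite /G.
by move: ((_ == u.1)%:R : F) ((_ == u.2)%:R : F) => e1 e2; ring.
Qed.

Hypothesis d_lt_n : (d < n)%N.

Let simplex : 'M[F]_(n, d) := \matrix_(v, k) (v == k :> nat)%:R.

Let hcoord_simplex v (j : 'I_d.+1) : (j < d)%N -> hcoord simplex v j = (v == j :> nat)%:R.
Proof. by move=> jd; rewrite /hcoord insubT /= mxE. Qed.

(** In a vanishing combination, the velocity of vertex [d], which sits at the origin, isolates each
    translation coefficient. The velocity of a vertex [j] below [d], in a coordinate [i] below [j],
    then isolates the coefficient of the rotation [(i, j)]. *)
Lemma motion_mx_simplex_free : row_free (motion_mx simplex).
Proof.
apply: inj_row_free => c cT0.
have coef v k : \sum_t c 0 t * motion simplex (enum_val t) v k = 0.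
  have := congr1 (fun M : 'rV_(n * d) => M 0 (mxvec_index v k)) cT0.
  by rewrite !mxE => {2}<-; apply: eq_bigr => t _; rewrite mxE mxvecE mxE.
pose e (t : 'I_#|pairs|) : 'I_d.+1 * 'I_d.+1 := enum_val t.
have e_inj : injective e := enum_val_inj.
have lt12 t : ((e t).1 < (e t).2)%N by have := enum_valP t; rewrite inE.
have lt1d t : ((e t).1 < d)%N by have := lt12 t; have := ltn_ord (e t).2; lia.
have hc0 (v : 'I_n) t : ((e t).1 == v :> nat) = false -> hcoord simplex v (e t).1 = 0.
  by move=> tv; rewrite hcoord_simplex // eq_sym tv.
have c_max t : (e t).2 = d :> nat -> c 0 t = 0.
  move=> t2; pose k := Ordinal (lt1d t).
  have := coef (Ordinal d_lt_n) k.
  have kE : widen_ord (leqnSn d) k = (e t).1 by apply/val_inj.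
  rewrite (bigD1 t) //= big1 ?addr0 => [|s st].
    rewrite motionE -/(e t) kE eqxx hc0 ?mul0r ?subr0; last by rewrite /= ltn_eqF.
    have -> : (e t).2 = ord_max by apply/val_inj.
    by rewrite hcoord_max !mulr1.
  rewrite motionE -/(e s) hc0 ?mul0r ?subr0; last by rewrite /= ltn_eqF.
  have [sd|sd] := ltnP (e s).2 d.
    by rewrite hcoord_simplex //= (gtn_eqF sd) mul0r mulr0.
  case: eqP => [ks|_]; last by rewrite !mulr0.
  case/eqP: st; apply: e_inj; rewrite [LHS]surjective_pairing [RHS]surjective_pairing.
  congr pair; first by rewrite -ks kE.
  by apply/val_inj; move: (ltn_ord (e s).2); rewrite /= t2; lia.
apply/rowP=> t; rewrite mxE.
have [t2|t2] := ltnP (e t).2 d; last by apply: c_max; move: (ltn_ord (e t).2); lia.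
pose k := Ordinal (lt1d t).
have kE : widen_ord (leqnSn d) k = (e t).1 by apply/val_inj.
have := coef (Ordinal (ltn_trans t2 d_lt_n)) k.
rewrite (bigD1 t) //= big1 ?addr0 => [|s st].
  rewrite motionE -/(e t) kE eqxx hc0 ?mul0r ?subr0; last by rewrite /= ltn_eqF.
  by rewrite hcoord_simplex //= eqxx !mulr1.
have [sd|sd] := ltnP (e s).2 d; last first.
  by rewrite c_max ?mul0r //; move: (ltn_ord (e s).2); lia.
rewrite motionE -/(e s) hcoord_simplex //= hcoord_simplex //=.
case: eqP => [ts|_]; last first.
  rewrite mul0r sub0r; case: eqP => [ts|_]; last by rewrite mul0r oppr0 mulr0.
  case: eqP => [ks|_]; last by rewrite mulr0 oppr0 mulr0.
  by have := lt12 s; have := lt12 t; rewrite -ts -ks /=; lia.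
case: eqP => [ks|_].
  case/eqP: st; apply: e_inj; rewrite [LHS]surjective_pairing [RHS]surjective_pairing.
  by congr pair; [rewrite -ks kE | apply/val_inj].
rewrite mulr0 sub0r; case: eqP => [ts1|_]; last by rewrite mul0r oppr0 mulr0.
by have := lt12 s; rewrite -ts -ts1 ltnn.
Qed.

(** All rows are orthogonal to the ['C(d.+1, 2)] motions, whose independence transfers from the
    simplex to [P]. *)
Lemma edge_span_rank_ub P (E : {set 'I_n * 'I_n}) : generic_pts P ->
  (\rank (edge_span P E) <= d * n - 'C(d.+1, 2))%N.
Proof.
move=> genP; rewrite -card_ltn_pairs.
have ET0 : edge_span P E *m (motion_mx P)^T = 0.
  apply/sub_kermxP/edge_span_subP=> u _; apply/sub_kermxP.
  apply: trmx_inj; rewrite trmx_mul trmxK trmx0.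
  apply/row_matrixP=> t; rewrite row_mul row0.
  by apply: trmx_inj; rewrite trmx_mul trmxK edge_row_motion trmx0.
have := mulmx0_rank_max ET0; rewrite mxrank_tr.
have -> : \rank (motion_mx P) = #|pairs|; last first.
  by move: (\rank _) #|_| => r m; rewrite (mulnC d); lia.
have TE (Q : 'M[F]_(n, d)) : motion_mx Q =
    map_mx (rat_eval (fun i => mxvec Q 0 i)) (motion_mx (generic_mx n d)).
  by rewrite map_motion_mx map_generic_mx.
apply/eqP; rewrite eqn_leq rank_leq_row /=.
have /eqP rk := motion_mx_simplex_free.
apply: leq_trans (_ : \rank (motion_mx simplex) <= _)%N; first by rewrite rk.
by rewrite (TE simplex) (TE P) mxrank_transfer.
Qed.

End TrivialMotions.

(** * Cliques of spanned pairs and vertex orderings *)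

Section Cliques.
Variables (F : numFieldType) (n d : nat) (P : 'M[F]_(n, d)).
Hypothesis genP : generic_pts P.
Implicit Types (S A N : {set 'I_n}).

Definition pairs_in S : {set 'I_n * 'I_n} := [set u | (u.1 \in S) && (u.2 \in S)].

Lemma edges_in_pairs S : edges_in S (pairs_in S).
Proof. by move=> u; rewrite inE. Qed.

Lemma pairs_inS S A : S \subset A -> pairs_in S \subset pairs_in A.
Proof.
by move=> /subsetP SA; apply/subsetP=> u; rewrite !inE => /andP[/SA -> /SA ->].
Qed.

Lemma clique_rank_step S v : v \notin S ->
  (\rank (edge_span P (pairs_in S)) + minn d #|S| <=
   \rank (edge_span P (pairs_in (v |: S))))%N.
Proof.
move=> vS; apply: leq_trans (zero_extension genP (@edges_in_pairs S) vS (subxx S)) _.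
apply/mxrankS/edge_spanS/subsetP=> u; rewrite !inE => /orP[/andP[-> ->]|].
  by rewrite !orbT.
by move=> /imsetP[w wS ->] /=; rewrite eqxx wS orbT.
Qed.

Lemma clique_rank_mono S A : S \subset A ->
  (\rank (edge_span P (pairs_in S)) + \sum_(#|S| <= i < #|A|) minn d i <=
   \rank (edge_span P (pairs_in A)))%N.
Proof.
move: {2}(#|A| - #|S|)%N (erefl (#|A| - #|S|)%N) => k.
elim: k A => [|k IHk] A kE SA.
  by rewrite big_geq ?addn0 ?mxrankS ?edge_spanS ?pairs_inS // -subn_eq0 kE.
have [v vA vS] : exists2 v, v \in A & v \notin S.
  by apply/subsetPn; apply/negP=> /subset_leq_card; lia.
have SA' : S \subset A :\ v.
  by rewrite subsetD1 SA.
have cA : #|A| = #|A :\ v|.+1 by rewrite (cardsD1 v) vA.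
rewrite cA big_nat_recr /=; last exact: subset_leq_card.
have := clique_rank_step (v := v) (S := A :\ v); rewrite setD1K // !inE eqxx.
move=> /(_ isT); apply: leq_trans; rewrite addnA leq_add2r IHk //; lia.
Qed.

(** The gains of successive 0-extensions add up to the maximal rank. *)
Lemma sum_minn m : (d <= m)%N ->
  (\sum_(0 <= i < m) minn d i + 'C(d.+1, 2))%N = (d * m)%N.
Proof.
move=> dm; rewrite (big_cat_nat (leq0n d) dm) //=.
rewrite (eq_big_nat _ _ (F2 := fun i => i)); last by move=> i; lia.
rewrite (@eq_big_nat _ _ _ d m _ (fun=> d)); last by move=> i; lia.
rewrite bin2_sum sum_nat_const_nat binS bin1.
have := mul_bin_diag d 1; rewrite bin1 bin2; nia.
Qed.

Hypothesis d_lt_n : (d < n)%N.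

Lemma rank_complete :
  \rank (edge_span P (pairs_in [set: 'I_n])) = (d * n - 'C(d.+1, 2))%N.
Proof.
apply/eqP; rewrite eqn_leq edge_span_rank_ub //=.
have := clique_rank_mono (sub0set [set: 'I_n]); rewrite cards0 cardsT card_ord.
by have := sum_minn (ltnW d_lt_n); lia.
Qed.

(** The lower bounds of [clique_rank_mono] from the empty set to [A] and from [A] to all vertices
    add up to the rank of the complete graph, so both are tight. *)
Lemma clique_rank A :
  \rank (edge_span P (pairs_in A)) = (\sum_(0 <= i < #|A|) minn d i)%N.
Proof.
have := clique_rank_mono (sub0set A); rewrite cards0.
have := clique_rank_mono (subsetT A); rewrite cardsT card_ord rank_complete.
have := sum_minn (ltnW d_lt_n).
have An : (#|A| <= n)%N by rewrite -[n in leqRHS]card_ord max_card.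
by rewrite (big_cat_nat (leq0n _) An) /=; lia.
Qed.

Variables (m : nat) (M : 'M[F]_(m, n * d)).

Definition spanned x y := (edge_row P x y <= M)%MS.

Lemma spannedC x y : spanned x y = spanned y x.
Proof. by rewrite /spanned edge_rowC. Qed.

Definition clique A := [forall x in A, forall y in A, spanned x y].

Lemma cliqueP A :
  reflect (forall x y, x \in A -> y \in A -> spanned x y) (clique A).
Proof.
apply: (iffP forall_inP) => [h x y xA|h x xA]; first exact: (forall_inP (h x xA)).
by apply/forall_inP=> y; apply: h.
Qed.

Lemma clique_span A : clique A -> (edge_span P (pairs_in A) <= M)%MS.
Proof.
by move/cliqueP=> cA; apply/edge_span_subP=> u; rewrite inE => /andP[]; apply: cA.
Qed.

(** A 0-extension of the complete graph on [A] with [d] new edges already has the rank of the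
    complete graph on [v |: A], hence the same row space. *)
Lemma clique_attach A v N : clique A -> v \notin A -> N \subset A ->
  (d <= #|N|)%N -> (forall u, u \in N -> spanned v u) -> clique (v |: A).
Proof.
move=> cA vA NA dN vN.
set X := pairs_in A :|: star v N.
have XA : X \subset pairs_in (v |: A).
  apply/subsetP=> u; rewrite !inE => /orP[/andP[-> ->]|]; first by rewrite !orbT.
  by case/imsetP=> w wN -> /=; rewrite eqxx (subsetP NA w wN) !orbT.
have XM : (edge_span P X <= M)%MS.
  rewrite edge_spanU addsmx_sub clique_span //=.
  by apply/edge_span_subP=> u /imsetP[w wN ->]; exact: vN.
have full : (edge_span P (pairs_in (v |: A)) <= edge_span P X)%MS.
  rewrite -(geq_leqif (mxrank_leqif_sup (edge_spanS P XA))) clique_rank.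
  rewrite cardsU1 vA add1n big_nat_recr //= -clique_rank.
  apply: leq_trans (zero_extension genP (@edges_in_pairs A) vA NA).
  by rewrite leq_add2l; lia.
apply/cliqueP=> x y xA yA; apply: submx_trans XM; apply: submx_trans full.
by apply: (@edge_row_sub _ _ _ P _ (x, y)); rewrite inE xA.
Qed.

Section Ordering.
Variable W : {set 'I_n}.
Implicit Type s : {perm 'I_n}.

Definition nbrs v := [set u in W | (u != v) && spanned v u].

Definition back_nbrs s v := [set u in nbrs v | (s u < s v)%N].

Let low s := [set v in W | (#|back_nbrs s v| < d)%N].
Let bad s := [set v in W | (d < #|back_nbrs s v|)%N && ~~ clique (back_nbrs s v)].

Let prefix s k := [set u in W | (s u < k)%N].
Let prefix_pairs s k :=
  [set u | [&& u.1 \in prefix s k, u.2 \in prefix s k & spanned u.1 u.2]].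

(** Vertices of [W] enter in the order [s]. Each entry is a 0-extension; for a bad vertex some pair
    of earlier neighbours is unspanned, and the 1-extension gains one more. *)
Lemma prefix_rank s k :
  (\sum_(v in prefix s k) (minn d #|back_nbrs s v| + (v \in bad s)) <=
   \rank (edge_span P (prefix_pairs s k)))%N.
Proof.
elim: k => [|k IHk].
  by rewrite big_pred0 // => v; rewrite inE andbF.
have ppS : prefix_pairs s k \subset prefix_pairs s k.+1.
  apply/subsetP=> u; rewrite !inE => /and3P[/andP[-> u1] /andP[-> u2] ->].
  by rewrite !(leq_trans _ (leqnSn k)).
have [[v vW sv]|nov] := altP (@exists_inP _ (mem W) (fun v => s v == k :> nat)); last first.
  rewrite (_ : prefix s k.+1 = prefix s k).
    exact: leq_trans IHk (mxrankS (edge_spanS _ ppS)).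
  apply/setP=> u; rewrite !inE ltnS leq_eqVlt; case: eqP => //= suk.
  case uW: (u \in W) => //=; move/exists_inP: nov; case.
  by exists u; last apply/eqP.
have sv' : s v = k :> nat := eqP sv; have vW' : v \in W := vW.
have vk : v \notin prefix s k by rewrite inE sv' ltnn andbF.
have prefE : prefix s k.+1 = v |: prefix s k.
  apply/setP=> u; rewrite !inE ltnS leq_eqVlt -sv' val_eqE (inj_eq perm_inj).
  by case: eqP => [->|]; rewrite ?vW'.
have BE : back_nbrs s v \subset prefix s k.
  by apply/subsetP=> u; rewrite !inE sv' => /andP[/and3P[-> _ _] ->].
rewrite prefE big_setU1 //= addnC.
apply: leq_trans (leq_add IHk (leqnn _)) _.
have ppin : edges_in (prefix s k) (prefix_pairs s k).
  by move=> u; rewrite !inE => /and3P[-> -> _].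
have newE : prefix_pairs s k :|: star v (back_nbrs s v) \subset prefix_pairs s k.+1.
  rewrite subUset ppS /=; apply/subsetP=> u /imsetP[w wB ->].
  rewrite inE /= prefE setU11 in_setU (subsetP BE) // orbT /=.
  by move: wB; rewrite !inE => /andP[/and3P[]].
have vbad : (v \in bad s) -> (\rank (edge_span P (prefix_pairs s k)) + d <
    \rank (edge_span P (prefix_pairs s k :|: star v (back_nbrs s v))))%N.
  rewrite inE vW' /= => /andP[dB]; rewrite negb_forall_in => /exists_inP[x xB].
  rewrite negb_forall_in => /exists_inP[y yB nxy].
  apply: (one_extension genP ppin vk BE dB xB yB).
  apply: contra nxy => /submx_trans; apply; apply/edge_span_subP=> u.
  by rewrite inE => /and3P[].
apply: leq_trans (mxrankS (edge_spanS P newE)).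
have [/vbad|_] := boolP (v \in bad s); last first.
  by rewrite addn0; apply: zero_extension ppin vk BE.
by apply: leq_trans; rewrite addn1 addnS ltnS leq_add2l geq_minl.
Qed.

(** In [prefix_rank] a vertex that is not low contributes [d] and a bad one yet another unit, while
    the total is at most [d * #|W|]. Low vertices thus pay for bad ones. *)
Lemma card_bad_low s : (#|bad s| <= d * #|low s|)%N.
Proof.
have prefT : prefix s n = W.
  by apply/setP=> u; rewrite !inE ltn_ord andbT.
have : (\rank (edge_span P (prefix_pairs s n)) <= d * #|W|)%N.
  apply: leq_trans (_ : \rank (edge_span P (pairs_in W)) <= _)%N.
    apply/mxrankS/edge_spanS/subsetP=> u; rewrite inE prefT => /and3P[u1 u2 _].
    by rewrite inE u1.
  rewrite clique_rank; apply: leq_trans (_ : \sum_(0 <= i < #|W|) d <= _)%N.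
    by apply: leq_sum => i _; rewrite geq_minl.
  by rewrite sum_nat_const_nat subn0 mulnC.
have := prefix_rank s n; rewrite prefT => /leq_trans h /h {h}.
rewrite big_split /=.
have -> : (\sum_(v in W) (v \in bad s) = #|bad s|)%N.
  rewrite -sum1_card big_mkcond [RHS]big_mkcond /=; apply: eq_bigr => v _.
  have [|_] := boolP (v \in bad s); last by rewrite if_same.
  by rewrite inE => /andP[->].
have lowle : (d * #|W| <= \sum_(v in W) minn d #|back_nbrs s v| + d * #|low s|)%N.
  have -> : (d * #|low s| = \sum_(v in W) d * (v \in low s))%N.
    rewrite -big_distrr /= -sum1_card big_mkcond [in RHS]big_mkcond /=; congr muln.
    apply: eq_bigr => v _; have [|_] := boolP (v \in low s); last by rewrite if_same.
    by rewrite inE => /andP[->].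
  rewrite mulnC -sum_nat_const -big_split /=; apply: leq_sum => v vW.
  by rewrite inE vW /=; case: ltnP => h; lia.
by move=> /leq_trans/(_ lowle); rewrite leq_add2l.
Qed.

End Ordering.
End Cliques.

(** * Closed graphs *)

Section RandomOrder.
Variable n : nat.
Implicit Types (T : {set 'I_n}) (s : {perm 'I_n}) (v : 'I_n).

Definition order_rank T s v := #|[set w in T | (s w < s v)%N]|.

Lemma card_order_rank_lt T s j :
  (#|[set u in T | (order_rank T s u < j)%N]| <= j)%N.
Proof.
set L := [set u in T | _].
have mono u w : u \in L -> (s u < s w)%N -> (order_rank T s u < order_rank T s w)%N.
  rewrite inE => /andP[uT _] uw; apply/proper_card/properP; split.
    by apply/subsetP=> z; rewrite !inE => /andP[-> /ltn_trans]; apply.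
  by exists u; rewrite !inE uT // ltnn.
have inj : {in L &, injective (order_rank T s)}.
  move=> u w uL wL e; apply: (@perm_inj _ s); apply/val_inj.
  by case: (ltngtP (s u) (s w)) => // [/(mono _ _ uL)|/(mono _ _ wL)]; rewrite e ltnn.
have [j0|j0] := posnP j.
  by rewrite j0 leqn0 cards_eq0; apply/eqP/setP=> u; rewrite !inE j0 ltn0 andbF.
pose f u : 'I_j := insubd (Ordinal j0) (order_rank T s u).
have fE u : u \in L -> f u = order_rank T s u :> nat.
  by rewrite inE => /andP[_ h]; rewrite /f val_insubd h.
rewrite -[leqRHS]card_ord -(card_in_imset (f := f)) ?max_card //.
by move=> u w uL wL /(congr1 val) /=; rewrite !fE //; apply: inj.
Qed.

(* Transposing v with any other element of T shows that all elements of T are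
   equally likely to have small rank. *)
Lemma card_perm_order_rank_lt T v j : v \in T ->
  (#|[set s | (order_rank T s v < j)%N]| * #|T| <= j * #|{perm 'I_n}|)%N.
Proof.
move=> vT.
have swap u : u \in T -> #|[set s | (order_rank T s u < j)%N]| =
                        #|[set s | (order_rank T s v < j)%N]|.
  move=> uT; rewrite -(card_imset _ (mulgI (tperm u v))); apply: eq_card => s.
  have rankE r : order_rank T (tperm u v * r) v = order_rank T r u.
    rewrite /order_rank -[RHS](card_imset _ (@perm_inj _ (tperm u v))).
    apply: eq_card => w; rewrite -[w in RHS](tpermK u v).
    rewrite mem_imset ?inE; last exact: perm_inj.
    rewrite !permM tpermR; congr (_ && _).
    by case: tpermP => [->|->|//]; rewrite ?uT ?vT.
  apply/imsetP/idP => [[r rL ->]|]; first by rewrite !inE rankE in rL *.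
  rewrite inE => sL; exists (tperm u v * s)%g; last by rewrite mulgA tperm2 mul1g.
  by rewrite inE -rankE mulgA tperm2 mul1g.
rewrite mulnC -sum_nat_const.
rewrite -(eq_bigr _ swap).
rewrite (eq_bigr (fun u => \sum_(s | (order_rank T s u < j)%N) 1)%N); last first.
  by move=> u _; rewrite -sum1_card; apply: eq_bigl => s; rewrite inE.
rewrite (exchange_big_dep xpredT) //= mulnC -sum_nat_const.
apply: leq_sum => s _; rewrite sum1_card.
apply: leq_trans (card_order_rank_lt T s j).
by apply/eq_leq/eq_card => u; rewrite !inE.
Qed.

End RandomOrder.

Section DenseSpan.
Variables (F : numFieldType) (n d : nat) (P : 'M[F]_(n, d)).
Hypotheses (genP : generic_pts P) (d_lt_n : (d < n)%N).
Variables (m : nat) (M : 'M[F]_(m, n * d)).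
Implicit Types (W A : {set 'I_n}).
Local Notation nbrs := (nbrs P M).
Local Notation back_nbrs := (back_nbrs P M).
Local Notation clique := (clique P M).

Variables (a D : nat).
Hypotheses (d_le_D : (d <= D)%N) (clique_le : forall A, clique A -> (#|A| <= a)%N).

(* The low back-degrees of card_bad_low have probability at most d / D, whereas
   a vertex of degree a + 2 D has more than a + d earlier neighbours with
   probability at least D / n, and then they cannot form a clique. *)
Lemma card_high_degree W :
  (forall v, v \in W -> D <= #|nbrs W v|)%N ->
  (#|[set v in W | a + 2 * D <= #|nbrs W v|]%N| * D ^ 2 <= d ^ 2 * n ^ 2)%N.
Proof.
move=> degW; set X := [set v in W | _].
set N := #|{perm 'I_n}|.
have N0 : (0 < N)%N by apply/card_gt0P; exists 1%g.
pose low s := [set v in W | (#|back_nbrs W s v| < d)%N].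
pose bad s := [set v in W | (d < #|back_nbrs W s v|)%N && ~~ clique (back_nbrs W s v)].
have bad_low s : (#|bad s| <= d * #|low s|)%N by apply: card_bad_low.
have exch (L : {perm 'I_n} -> {set 'I_n}) :
    (\sum_s #|L s| = \sum_v #|[set s | v \in L s]|)%N.
  under eq_bigr do rewrite -sum1_card.
  rewrite (exchange_big_dep xpredT) //=; apply: eq_bigr => v _.
  by rewrite -sum1_card; apply: eq_bigl => s; rewrite inE.
(* The back-degree of [v] is its rank within [v |: nbrs W v], where all [#|nbrs W v|.+1] ranks are
   equally likely. *)
have count v j : v \in W ->
    (#|[set s | (#|back_nbrs W s v| < j)%N]| * #|nbrs W v|.+1 <= j * N)%N.
  move=> vW; have vN : v \notin nbrs W v by rewrite inE eqxx andbF.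
  have := card_perm_order_rank_lt j (setU11 v (nbrs W v)).
  rewrite cardsU1 vN add1n; apply: leq_trans.
  rewrite leq_mul2r /=; apply/eq_leq/eq_card => s.
  rewrite !inE; congr (_ < _)%N; apply: eq_card => u; rewrite !inE.
  by case: (eqVneq u v) => [->|]; rewrite //= ltnn !andbF.
have low_count v : v \in W -> (#|[set s | v \in low s]| * D <= d * N)%N.
  move=> vW; apply: leq_trans (count v d vW).
  apply: leq_mul; last exact: leqW (degW v vW).
  by apply/subset_leq_card/subsetP=> s; rewrite !inE => /andP[].
have bad_count v : v \in X -> (D * N <= n * #|[set s | v \in bad s]|)%N.
  rewrite inE => /andP[vW degv].
  set c := #|_|; set c' := #|[set s | (#|back_nbrs W s v| < (a + d).+1)%N]|.
  have cc' : (N <= c + c')%N.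
    rewrite /N -cardsT -(cardsID [set s | (#|back_nbrs W s v| < (a + d).+1)%N]).
    rewrite addnC leq_add // subset_leq_card //; apply/subsetP=> s; rewrite !inE ?andbT //.
    rewrite vW ltnS -ltnNge => h /=; apply/andP; split.
      by apply: leq_trans h; rewrite ltnS leq_addl.
    apply/negP=> /clique_le; rewrite leqNgt => /negP; apply.
    by apply: leq_trans h; rewrite ltnS leq_addr.
  have cnt := count v (a + d).+1 vW; rewrite -/c' in cnt.
  have degn : (#|nbrs W v|.+1 <= n)%N.
    rewrite -[n in leqRHS](card_ord n) -cardsT (cardsD1 v [set: 'I_n]) inE add1n ltnS.
    apply/subset_leq_card/subsetP=> u; rewrite !inE => /and3P[_ -> _] //.
  move: #|nbrs W v| degv cnt degn => k degv cnt degn.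
  have h1 : (k.+1 * N <= k.+1 * (c + c'))%N by rewrite leq_mul2l cc' orbT.
  have h2 : (k.+1 * c <= n * c)%N by rewrite leq_mul2r degn orbT.
  have h3 : ((a + d).+1 * N + D * N <= k.+1 * N)%N.
    by rewrite -mulnDl leq_mul2r; apply/orP; right; lia.
  by rewrite mulnDr (mulnC k.+1 c') in h1; lia.
have sumX : (#|X| * (D * N) <= n * \sum_s #|bad s|)%N.
  rewrite exch big_distrr /= -sum_nat_const big_mkcond /=; apply: leq_sum => v _.
  by case: ifP => // /bad_count.
have sumL : ((\sum_s #|low s|) * D <= n * (d * N))%N.
  rewrite exch big_distrl /= -[n in leqRHS]card_ord -sum_nat_const; apply: leq_sum => v _.
  have [/low_count //|vW] := boolP (v \in W).
  rewrite (_ : [set s | _] = set0) ?cards0 //.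
  by apply/setP=> s; rewrite !inE (negPf vW).
have sumBL : (\sum_s #|bad s| <= d * \sum_s #|low s|)%N.
  by rewrite big_distrr /=; apply: leq_sum.
rewrite -(leq_pmul2r N0).
move: sumX sumL sumBL; move: (\sum_s #|bad s|)%N (\sum_s #|low s|)%N => sb sl.
clear -n; move: #|X| => x; move: N => N h1 h2 h3.
have h4 : (x * (D * N) * D <= n * (d * sl) * D)%N.
  by apply: leq_mul => //; apply: leq_trans h1 _; apply: leq_mul.
have h5 : (n * d * (sl * D) <= n * d * (n * (d * N)))%N by apply: leq_mul.
nia.
Qed.

Definition span_pairs := [set u : 'I_n * 'I_n | (u.1 < u.2)%N & spanned P M u.1 u.2].

(** Inside a subset of minimum degree [D], all but [x] vertices have degree below [a + 2 * D].
    Pruning down to such a subset costs at most [2 * D * n] ordered pairs. *)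
Lemma card_span_pairs :
  exists2 x, (x * D ^ 2 <= d ^ 2 * n ^ 2)%N &
             (2 * #|span_pairs| <= n * (a + 4 * D + x))%N.
Proof.
pose adj x y : nat := (y != x) && spanned P M x y.
have adjC x y : adj x y = adj y x by rewrite /adj eq_sym spannedC.
have adjxx x : adj x x = 0%N by rewrite /adj eqxx.
have nbrsE W v : #|nbrs W v| = (\sum_(w in W) adj v w)%N.
  rewrite -sum1_card big_mkcond [RHS]big_mkcond /=; apply: eq_bigr => w _.
  by rewrite inE /adj; case: (w \in W); case: (w != v); case: (spanned P M v w).
pose C W := (\sum_(v in W) #|nbrs W v|)%N.
have C_remove W v : v \in W -> C W = (C (W :\ v) + 2 * #|nbrs W v|)%N.
  move=> vW; rewrite /C (big_setD1 v) //=.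
  rewrite (eq_bigr (fun u => #|nbrs (W :\ v) u| + adj v u)%N); last first.
    by move=> u _; rewrite !nbrsE (big_setD1 v) //= addnC adjC.
  have e : #|nbrs W v| = (\sum_(w in W :\ v) adj v w)%N.
    by rewrite nbrsE (big_setD1 v) //= adjxx.
  by rewrite big_split /= -e addnCA addnn mul2n.
(* For a maximizer W every degree inside W is at least D, and few pairs are lost
   outside W. *)
pose val W := (C W + 2 * D * #|~: W|)%N.
case: (@arg_maxnP _ [set: 'I_n] xpredT val isT) => W _ Wmax.
have degW v : v \in W -> (D <= #|nbrs W v|)%N.
  move=> vW; have : (val (W :\ v) <= val W)%N := Wmax _ isT; rewrite /val (C_remove W v vW).
  have -> : #|~: (W :\ v)| = #|~: W|.+1.
    have -> : ~: (W :\ v) = v |: ~: W.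
      by apply/setP=> u; rewrite !inE negb_and negbK.
    by rewrite cardsU1 !inE vW.
  by rewrite mulnS addnA leq_add2r leq_add2l leq_mul2l.
pose x := #|[set v in W | (a + 2 * D <= #|nbrs W v|)%N]|.
exists x; first exact: card_high_degree.
have CW : (C W <= n * (a + 2 * D + x))%N.
  pose X := [set v in W | (a + 2 * D <= #|nbrs W v|)%N].
  apply: leq_trans (_ : \sum_(v in W) (a + 2 * D + n * (v \in X)) <= _)%N.
    apply: leq_sum => v vW; rewrite inE vW /=.
    case: (leqP (a + 2 * D)%N) => [_|/ltnW h]; last by rewrite muln0 addn0.
    rewrite muln1; apply: leq_trans (leq_addl _ _).
    by rewrite -[n in leqRHS]card_ord max_card.
  rewrite big_split /= -big_distrr /= mulnDr leq_add //.
    by rewrite sum_nat_const leq_mul2r -[n in leqRHS]card_ord max_card orbT.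
  rewrite leq_mul2l; apply/orP; right.
  rewrite /x -sum1_card [leqRHS]big_mkcond [leqLHS]big_mkcond /=.
  by apply: leq_sum => v _; rewrite inE; case: (v \in W).
have CT : (C [set: 'I_n] <= C W + 2 * D * n)%N.
  have : (val setT <= val W)%N := Wmax _ isT.
  rewrite /val setCT cards0 muln0 addn0 => /leq_trans; apply.
  by rewrite leq_add2l leq_mul2l -[n in leqRHS]card_ord max_card orbT.
suff -> : (2 * #|span_pairs|)%N = C [set: 'I_n].
  apply: leq_trans CT _; apply: leq_trans (leq_add CW (leqnn _)) _.
  rewrite (mulnC _ n) -mulnDr leq_mul2l; apply/orP; right.
  by move: (x); clear; lia.
have -> : C setT = #|[set u : 'I_n * 'I_n | (u.2 != u.1) && spanned P M u.1 u.2]|.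
  rewrite /C; under eq_bigr do rewrite nbrsE.
  rewrite pair_big /= -sum1_card [RHS]big_mkcond.
  apply: eq_big => [u|u _]; first by rewrite !inE.
  by rewrite inE /adj; case: (_ && _).
set Y := [set u | _].
have -> : #|Y| = (#|span_pairs| + #|Y :\: span_pairs|)%N.
  rewrite -(cardsID span_pairs Y) (setIidPr _) //; apply/subsetP=> u.
  by rewrite !inE => /andP[lt ->]; rewrite andbT neq_ltn lt orbT.
have -> : #|Y :\: span_pairs| = #|span_pairs|; last by rewrite mul2n addnn.
have swapI : injective (fun u : 'I_n * 'I_n => (u.2, u.1)) by case=> [? ?] [? ?] [-> ->].
rewrite -(card_imset span_pairs swapI); apply: eq_card => u; apply/idP/imsetP.
  rewrite !inE negb_and => /andP[h1 /andP[h2 h3]].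
  exists (u.2, u.1); last by case: u {h1 h2 h3}.
  move: h1; rewrite inE /= (spannedC _ _ u.2) h3 /= orbF andbT -leqNgt leq_eqVlt.
  by rewrite eq_sym => /orP[/eqP/val_inj e|//]; rewrite e eqxx in h2.
case=> [w]; rewrite inE => /andP[lt sp] ->; rewrite !inE /= spannedC sp andbT.
by rewrite [w.1 != _]neq_ltn lt /= andbT -leqNgt ltnW.
Qed.

End DenseSpan.

(** * A deterministic criterion *)

Section EdgeCounts.
Variable n : nat.
Implicit Types (E : {set 'I_n * 'I_n}) (A U : {set 'I_n}) (v : 'I_n).

Definition incident v : {set 'I_n * 'I_n} := [set u | (u.1 == v) || (u.2 == v)].

Definition ends_in E v A := [set w in A | ((v, w) \in E) || ((w, v) \in E)].

(** Sending an incident edge to its other endpoint is injective because each edge is stored once,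
    smaller endpoint first. *)
Lemma card_ends_in E v A : E \subset all_pairs n ->
  #|ends_in E v A| =
  #|[set u in E :&: incident v | (if u.1 == v then u.2 else u.1) \in A]|.
Proof.
move=> /subsetP Elt; set I := [set u in _ | _].
pose f (u : 'I_n * 'I_n) := if u.1 == v then u.2 else u.1.
have lt u : u \in E -> (u.1 < u.2)%N by move=> /Elt; rewrite inE.
have f_inj : {in I &, injective f}.
  move=> [a b] [a' b']; rewrite !inE /f /= => /andP[/andP[/lt /= ab ev]] _.
  move=> /andP[/andP[/lt /= ab' ev']] _.
  move: ev ev'; case: (eqVneq a v) => [av|_] /=; case: (eqVneq a' v) => [av'|_] //=.
  - by move=> _ _ ->; rewrite av av'.
  - move=> _ /eqP bv' e; move: ab ab'; rewrite av bv' e => h /(ltn_trans h).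
    by rewrite ltnn.
  - move=> /eqP bv _ e; move: ab ab'; rewrite av' bv e => h h'.
    by have := ltn_trans h h'; rewrite ltnn.
  - by move=> /eqP bv /eqP bv' ->; rewrite bv bv'.
rewrite -(card_in_imset f_inj); apply: eq_card => w; apply/idP/imsetP.
  rewrite inE => /andP[wA /orP[vw|wv]].
    by exists (v, w); rewrite ?inE /f /= eqxx ?vw.
  have wv_neq : (w == v) = false by apply/negP=> /eqP e; have := lt _ wv; rewrite e ltnn.
  by exists (w, v); rewrite ?inE /f /= wv_neq ?wv ?eqxx.
case=> [[a b]]; rewrite !inE /f /= => /andP[/andP[abE]].
by case: (eqVneq a v) => [<- _ wA ->|_ /= /eqP <- wA ->]; rewrite wA abE ?orbT.
Qed.

Lemma card_incident E v A : E \subset all_pairs n ->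
  (#|E :&: incident v| = #|ends_in E v A| + #|ends_in E v (~: A)|)%N.
Proof.
move=> Elt; rewrite !card_ends_in //.
rewrite -(cardsID [set u | (if u.1 == v then u.2 else u.1) \in A]); congr (_ + _)%N.
  by apply: eq_card => u; rewrite !inE.
by apply: eq_card => u; rewrite !inE andbC.
Qed.

(** Handshake count: an edge inside [U] is seen at most from its two ends. *)
Lemma sum_ends_in E U : E \subset all_pairs n ->
  (\sum_(v in U) #|ends_in E v U| <= 2 * #|E :&: pairs_in U|)%N.
Proof.
move=> Elt.
pose g (u : 'I_n * 'I_n) v : nat := ((v == u.1) + (v == u.2))%N.
apply: leq_trans (_ : \sum_(v in U) \sum_(u in E :&: pairs_in U) g u v <= _)%N.
  apply: leq_sum => v vU; rewrite card_ends_in // -sum1_card.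
  rewrite big_mkcond [leqRHS]big_mkcond /=; apply: leq_sum => u _.
  rewrite !inE /g ![v == _]eq_sym; case uE: (u \in E) => //=.
  case: (eqVneq u.1 v) => [->|_] /=.
    by rewrite vU /=; case: (u.2 \in U); rewrite ?leq_addr.
  by case: (eqVneq u.2 v) => [->|_] //=; rewrite vU andbT; case: (u.1 \in U).
rewrite exchange_big /= mulnC -sum_nat_const; apply: leq_sum => u _.
rewrite big_split /= (leq_add (n1 := 1) (n2 := 1)) //.
  apply: leq_trans (_ : \sum_v (v == u.1) <= 1)%N.
    by rewrite big_mkcond; apply: leq_sum => v _; case: (v \in U).
  by rewrite (bigD1 u.1) //= eqxx big1 // => v /negPf ->.
apply: leq_trans (_ : \sum_v (v == u.2) <= 1)%N.
  by rewrite big_mkcond; apply: leq_sum => v _; case: (v \in U).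
by rewrite (bigD1 u.2) //= eqxx big1 // => v /negPf ->.
Qed.

Lemma card_all_pairs_in U : (2 * #|all_pairs n :&: pairs_in U| <= #|U| ^ 2)%N.
Proof.
set X := _ :&: _.
have swapI : injective (fun u : 'I_n * 'I_n => (u.2, u.1)) by case=> [? ?] [? ?] [-> ->].
have dis : [disjoint X & [set (u.2, u.1) | u in X]].
  rewrite -setI_eq0; apply/eqP/setP=> u; rewrite in_setI in_set0; apply/negP=> /andP[].
  move=> + /imsetP[w]; rewrite !inE => /andP[lt _] /andP[lt' _] e.
  by move: lt; rewrite e /= ltnNge ltnW.
rewrite mul2n -addnn -[X in (_ + X <= _)%N](card_imset X swapI).
rewrite -cardsUI (disjoint_setI0 dis) cards0 addn0 -mulnn -cardsX.
apply/subset_leq_card/subsetP=> -[x y].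
rewrite in_setU in_setX => /orP[|/imsetP[w + [-> ->]]] /=.
  by rewrite !inE => /andP[].
by rewrite !inE => /andP[_ /andP[-> ->]].
Qed.

Lemma card_all_pairs : (2 * #|all_pairs n| = n * n.-1)%N.
Proof.
rewrite card_ltn_pairs bin2 mul2n; apply: even_halfK.
by case: (n) => // k; rewrite oddM /= andNb.
Qed.

Lemma card_all_pairs_incident v : #|all_pairs n :&: incident v| = n.-1.
Proof.
rewrite (card_incident v setT (subxx _)) setCT.
rewrite [X in (_ + X)%N](_ : _ = 0%N) ?addn0; last first.
  by apply/eqP; rewrite cards_eq0; apply/eqP/setP=> w; rewrite !inE.
rewrite -[in RHS](card_ord n) -cardsT (cardsD1 v setT) inE add1n /=.
apply: eq_card => w; rewrite !inE /= andbT -neq_ltn eq_sym.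
by rewrite -val_eqE.
Qed.

End EdgeCounts.

Section Criterion.
Variables (F : numFieldType) (n d : nat) (P : 'M[F]_(n, d)).
Hypotheses (genP : generic_pts P) (d_lt_n : (d < n)%N).

(** When [A] is a clique of the closure of [E], this is the closure itself. Being defined for every
    [A], it allows a union bound over [A] although the largest clique depends on [E]. *)
Definition span_over (A : {set 'I_n}) (E : {set 'I_n * 'I_n}) : {set 'I_n * 'I_n} :=
  [set u in all_pairs n |
    (edge_row P u.1 u.2 <= edge_span P (pairs_in A) + edge_span P E)%MS].

(* Let A be a largest clique of the closure of E.  The last hypothesis forces A
   to miss at most b vertices; by maximality each vertex outside A has fewer
   than d neighbours in A, hence more than k outside A, against the second
   hypothesis. *)
Lemma rigidity_criterion (E : {set 'I_n * 'I_n}) (D b k : nat) :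
  E \subset all_pairs n -> (0 < D)%N -> (d <= D)%N ->
  (forall v, d + k <= #|E :&: incident v|)%N ->
  (forall U : {set 'I_n}, U != set0 -> (#|U| <= b)%N ->
     2 * #|E :&: pairs_in U| < #|U| * k.+1)%N ->
  (forall A : {set 'I_n}, (#|A| + b < n)%N ->
     n * (#|A| + 4 * D + (d ^ 2 * n ^ 2) %/ D ^ 2) < 2 * #|span_over A E|)%N ->
  \rank (edge_span P E) = (d * n - 'C(d.+1, 2))%N.
Proof.
move=> Elt D0 dD degE sparse dense; set M := edge_span P E.
have clique0 : clique P M set0 by apply/cliqueP=> x y; rewrite inE.
case: (@arg_maxnP _ set0 (clique P M) (fun A => #|A|) clique0) => A cA maxA.
have Amax B : clique P M B -> (#|B| <= #|A|)%N by apply: maxA.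
have [x xD leC] := card_span_pairs genP d_lt_n dD Amax.
have bigA : (n <= #|A| + b)%N.
  rewrite leqNgt; apply/negP=> /dense; rewrite ltnNge => /negP; apply.
  (* The rows of the pairs in the clique [A] already lie in [M]. *)
  have -> : span_over A E = span_pairs P M.
    apply/setP=> u; rewrite !inE; congr (_ && _); rewrite /spanned.
    have := addsmx_idPr (clique_span cA); rewrite -/M => AM.
    by rewrite AM.
  apply: leq_trans leC _; rewrite leq_mul2l leq_add2l leq_divRL ?xD ?orbT //.
  by rewrite expn_gt0 D0.
have [U0|U0] := eqVneq (~: A) set0.
  have AT : A = setT by rewrite -[A]setCK U0 setC0.
  apply/eqP; rewrite eqn_leq edge_span_rank_ub //=.
  by rewrite -(rank_complete genP d_lt_n) mxrankS // -AT clique_span.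
have Ub : (#|~: A| <= b)%N by rewrite cardsCs setCK card_ord; lia.
have := sparse _ U0 Ub; rewrite ltnNge => /negP; case.
apply: leq_trans (sum_ends_in _ Elt); rewrite -sum_nat_const.
apply: leq_sum => v; rewrite inE => vA.
have := degE v; rewrite (card_incident v A Elt).
suff : (#|ends_in E v A| < d)%N by lia.
rewrite ltnNge; apply/negP=> dN.
have NA : ends_in E v A \subset A by apply/subsetP=> w; rewrite inE => /andP[].
have := clique_attach genP d_lt_n cA vA NA dN _.
have H w : w \in ends_in E v A -> spanned P M v w.
  rewrite inE => /andP[_ /orP[]] /(edge_row_sub P) //=.
  by rewrite spannedC.
by move=> /(_ H) /Amax; rewrite cardsU1 vA ltnn.
Qed.

End Criterion.

(** * Random subsets *)

Section RandomSubset.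
Variables (R : realFieldType) (T : finType) (p : R).
Implicit Types (X Y E : {set T}) (f g : {set T} -> R).

(** Expectation over a random subset of [X] with independent elements of probability [p]. The ground
    set varies so that elements can be exposed one at a time. *)
Definition Esub X f : R :=
  \sum_(E in powerset X) p ^+ #|E| * (1 - p) ^+ (#|X| - #|E|) * f E.

Lemma Esub_set0 f : Esub set0 f = f set0.
Proof.
rewrite /Esub powerset0 big_set1 cards0 subn0 !expr0.
by rewrite !mul1r.
Qed.

Lemma Esub_setU1 e X f : e \notin X ->
  Esub (e |: X) f = p * Esub X (fun E => f (e |: E)) + (1 - p) * Esub X f.
Proof.
move=> eX; rewrite /Esub [RHS]addrC (bigID (fun E : {set T} => e \notin E)) /=.
have eXc : #|e |: X| = #|X|.+1 by rewrite cardsU1 eX.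
have subX E : (E \in powerset (e |: X)) && (e \notin E) = (E \in powerset X).
  rewrite !powersetE; apply/andP/idP => [[/subsetP EX eE]|EX].
    by apply/subsetP=> u uE; have := EX u uE; rewrite !inE (negPf (memPn eE u uE)).
  by rewrite (subset_trans EX (subsetUr _ _)) (contra (subsetP EX e)).
congr (_ + _).
  rewrite mulr_sumr; apply: eq_big => [E|E]; first exact: subX.
  rewrite subX powersetE => /subset_leq_card EX.
  by rewrite eXc subSn // exprS mulrCA !mulrA.
rewrite mulr_sumr (reindex_onto (fun E => e |: E) (fun E => E :\ e)) /=; last first.
  by move=> E /andP[_]; rewrite negbK; apply: setD1K.
apply: eq_big => [E|E].
  rewrite powersetE setU11 /= andbT subUset sub1set setU11 /= powersetE.
  apply/andP/idP => [[EX /eqP EE]|EX].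
    apply/subsetP=> u uE; have := subsetP EX u uE; rewrite !inE => /orP[/eqP ue|//].
    by move: uE; rewrite -EE ue !inE eqxx.
  rewrite (subset_trans EX (subsetUr _ _)) setU1K //.
  exact: contra (subsetP EX e) eX.
move=> /andP[_ /eqP EE].
have eE : e \notin E by rewrite -EE !inE eqxx.
by rewrite cardsU1 eE eXc subSS exprS -!mulrA.
Qed.

Lemma EsubZ c X f : Esub X (fun E => c * f E) = c * Esub X f.
Proof. by rewrite /Esub mulr_sumr; apply: eq_bigr => E _; rewrite mulrCA. Qed.

Lemma EsubD X f g : Esub X (fun E => f E + g E) = Esub X f + Esub X g.
Proof. by rewrite /Esub -big_split; apply: eq_bigr => E _; rewrite mulrDr. Qed.

Lemma Esub_sum (I : finType) (A : {pred I}) X (f : I -> {set T} -> R) :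
  Esub X (fun E => \sum_(i in A) f i E) = \sum_(i in A) Esub X (f i).
Proof.
rewrite /Esub exchange_big; apply: eq_bigr => E _.
by rewrite mulr_sumr.
Qed.

Lemma eq_Esub X f g : (forall E, E \subset X -> f E = g E) -> Esub X f = Esub X g.
Proof. by move=> fg; apply: eq_bigr => E; rewrite powersetE => /fg ->. Qed.

(** Generating function of the binomial variable [#|E :&: Y|]: each element of [Y] in [X]
    contributes an independent factor. *)
Lemma Esub_expr X Y (t : R) :
  Esub X (fun E => t ^+ #|E :&: Y|) = (1 - p + p * t) ^+ #|X :&: Y|.
Proof.
elim: {X}_.+1 {-2}X (ltnSn #|X|) => // k IHk X Xk.
have [->|[e eX]] := set_0Vmem X; first by rewrite Esub_set0 set0I cards0 !expr0.
have eXe : e \notin X :\ e by rewrite !inE eqxx.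
have Xek : (#|X :\ e| < k)%N by move: Xk; rewrite (cardsD1 e X) eX.
rewrite -(setD1K eX) Esub_setU1 //.
rewrite (eq_Esub (g := fun E => t ^+ (e \in Y) * t ^+ #|E :&: Y|)).
  rewrite EsubZ !IHk // setIUl cardsU.
  have -> : [set e] :&: Y :&: ((X :\ e) :&: Y) = set0.
    by apply/setP=> u; rewrite !inE; case: eqP; rewrite ?andbF.
  rewrite cards0 subn0 exprD; have [eY|eY] := boolP (e \in Y).
    have -> : [set e] :&: Y = [set e] by apply/setIidPl; rewrite sub1set.
    by rewrite cards1 !expr1; move: (_ ^+ _) => z; ring.
  rewrite (_ : [set e] :&: Y = set0) ?cards0 ?expr0.
    by move: (_ ^+ _) => z; ring.
  by apply/setP=> u; rewrite !inE; case: eqP => // ->; rewrite (negPf eY).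
move=> E EX; have eE : e \notin E by apply: contra eXe; apply: (subsetP EX).
rewrite -exprD; congr (_ ^+ _); rewrite setIUl cardsU.
have -> : [set e] :&: Y :&: (E :&: Y) = set0.
  by apply/setP=> u; rewrite !inE; case: eqP => [->|]; rewrite ?(negPf eE) ?andbF.
rewrite cards0 subn0; congr addn; have [eY|eY] := boolP (e \in Y).
  have -> : [set e] :&: Y = [set e] by apply/setIidPl; rewrite sub1set.
  by rewrite cards1.
apply/eqP; rewrite cards_eq0; apply/eqP/setP=> u; rewrite !inE.
by case: eqP => // ->; rewrite (negPf eY).
Qed.

Hypothesis p01 : 0 <= p <= 1.

Lemma ler_Esub X f g : (forall E, E \subset X -> f E <= g E) -> Esub X f <= Esub X g.
Proof.
case/andP: p01 => p0 p1 fg; apply: ler_sum => E; rewrite powersetE => EX.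
by rewrite ler_wpM2l ?fg // mulr_ge0 // exprn_ge0 // subr_ge0.
Qed.

Lemma Esub_cst X (c : R) : Esub X (fun=> c) = c.
Proof.
rewrite -[RHS]mulr1 -[X in _ = c * X](expr1n R #|X :&: setT|).
have one : 1 = 1 - p + p * 1 by ring.
rewrite [X in _ = c * (X ^+ _)]one -Esub_expr -EsubZ; apply: eq_Esub => E _.
by rewrite expr1n mulr1.
Qed.

(* Elements of X are exposed one at a time: each one either lies in the current
   span, or enlarges it with probability p. *)
Lemma Esub_span_le (K : fieldType) (q : nat) (r : T -> 'rV[K]_q) (t : R)
    (X : {set T}) (W : 'M[K]_q) (h := 1 - p + p * t) :
  0 <= t <= 1 ->
  Esub X (fun E => t ^+ \rank (W + \sum_(e in E) << r e >>)%MS *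
    h ^+ #|[set e in X | (r e <= W + \sum_(e in E) << r e >>)%MS]|) <=
  t ^+ \rank W * h ^+ #|X|.
Proof.
case/andP: p01 => p0 p1 /andP[t0 t1].
have h0 : 0 <= h by rewrite addr_ge0 ?subr_ge0 ?mulr_ge0.
have h1 : h <= 1.
  by rewrite /h -[leRHS](subrK p) lerD2l ler_piMr.
pose S (W : 'M[K]_q) (E : {set T}) : 'M[K]_q := (W + \sum_(e in E) << r e >>)%MS.
pose cl (X : {set T}) (W : 'M[K]_q) (E : {set T}) := #|[set e in X | (r e <= S W E)%MS]|.
change (Esub X (fun E => t ^+ \rank (S W E) * h ^+ cl X W E) <= t ^+ \rank W * h ^+ #|X|).
elim: {X}_.+1 {-2}X (ltnSn #|X|) W => // k IHk X Xk W.
have [->|[e eX]] := set_0Vmem X.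
  have cl0 : cl set0 W set0 = 0%N.
    by apply/eqP; rewrite cards_eq0; apply/eqP/setP=> u; rewrite !inE.
  by rewrite Esub_set0 cl0 cards0 /S big_set0 addsmx0.
set X' := X :\ e; have eX' : e \notin X' by rewrite !inE eqxx.
have X'k : (#|X'| < k)%N by move: Xk; rewrite (cardsD1 e X) eX.
have XE : X = e |: X' by rewrite setD1K.
have clX V E : cl X V E = ((r e <= S V E)%MS + cl X' V E)%N.
  rewrite /cl (cardsD1 e) !inE eX /=; congr (_ + _)%N; apply: eq_card => u.
  by rewrite !inE andbA.
have cX : #|X| = #|X'|.+1 by rewrite (cardsD1 e X) eX.
have SU E : E \subset X' -> (S W (e |: E) :=: S (W + << r e >>)%MS E)%MS.
  move=> EX; have eE : e \notin E by apply: contra eX'; apply: (subsetP EX).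
  by apply/eqmxP; rewrite /S big_setU1 //= addsmxA submx_refl.
have reU E : E \subset X' -> (r e <= S W (e |: E))%MS.
  move=> EX; rewrite SU //; apply: submx_trans (addsmxSl _ _).
  by apply: submx_trans (addsmxSr _ _); rewrite genmxE.

rewrite [X in Esub X]XE Esub_setU1 // cX exprS.
have [We|We] := boolP (r e <= W)%MS.
  have SWe E : E \subset X' -> (S W (e |: E) :=: S W E)%MS.
    move=> EX; apply: eqmx_trans (SU E EX) _; apply/eqmxP; rewrite /S.
    apply/andP; split; rewrite !addsmx_sub ?genmxE !addsmxSr ?addsmxSl ?andbT /=.
      exact: submx_trans We (addsmxSl _ _).
    exact: submx_trans (addsmxSl W _) (addsmxSl _ _).
  (* [V] is the identity or adds [e]: as its row lies in [W], [e] leaves the span unchanged and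
     contributes a factor [h], present or not. *)
  have bound V : (forall E, E \subset X' -> (S W E :=: S W (V E))%MS) ->
      Esub X' (fun E => t ^+ \rank (S W (V E)) * h ^+ cl X W (V E)) <=
      h * (t ^+ \rank W * h ^+ #|X'|).
    move=> SV; apply: le_trans (ler_wpM2l h0 (IHk _ X'k W)); rewrite -EsubZ.
    rewrite (eq_Esub (g := fun E => h * (t ^+ \rank (S W E) * h ^+ cl X' W E))) // => E EX.
    have reS : (r e <= S W (V E))%MS.
      by rewrite -(SV E EX); apply: submx_trans We (addsmxSl _ _).
    rewrite clX reS -(SV E EX) exprS mulrCA.
    congr (_ * (_ * _ ^+ _)); apply: eq_card => u; rewrite !inE.
    by rewrite (SV E EX).
  apply: le_trans (lerD (ler_wpM2l p0 (bound (fun E => e |: E) _))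
                        (ler_wpM2l _ (bound id _))) _ => //.
  - by move=> E EX; apply: eqmx_sym; apply: SWe.
  - by rewrite subr_ge0.
  - by rewrite -mulrDl addrC subrK mul1r mulrCA.
(* For a new row, presence of [e] costs a factor [t] for the rank and [h] for the spanned element,
   and absence at most a factor 1. The total [p * t * h + (1 - p)] is at most [h] because
   [h <= 1]. *)
have rW : \rank (W + << r e >>)%MS = (\rank W).+1.
  apply/eqP; rewrite eqn_leq; apply/andP; split.
    rewrite -[leqRHS]addn1; apply: leq_trans (mxrank_adds_leqif _ _) _.
    by rewrite leq_add2l genmxE rank_leq_row.
  have := mxrank_leqif_sup (addsmxSl W << r e >>%MS); rewrite ltn_neqAle => -[-> ->].
  by rewrite addsmx_sub submx_refl genmxE (negPf We).
have inB : Esub X' (fun E => t ^+ \rank (S W (e |: E)) * h ^+ cl X W (e |: E)) <=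
    h * (t * t ^+ \rank W * h ^+ #|X'|).
  rewrite -exprS -rW; apply: le_trans (ler_wpM2l h0 (IHk _ X'k _)); rewrite -EsubZ.
  pose We' := (W + << r e >>)%MS.
  rewrite (eq_Esub (g := fun E => h * (t ^+ \rank (S We' E) * h ^+ cl X' We' E)))
    // => E EX.
  rewrite clX reU //= exprS mulrCA (SU E EX); congr (_ * (_ * _ ^+ _)).
  by apply: eq_card => u; rewrite !inE SU.
have outB : Esub X' (fun E => t ^+ \rank (S W E) * h ^+ cl X W E) <=
    t ^+ \rank W * h ^+ #|X'|.
  apply: le_trans (IHk _ X'k W); apply: ler_Esub => E EX.
  by rewrite ler_wpM2l ?exprn_ge0 // clX ler_wiXn2l // leq_addl.
apply: le_trans (lerD (ler_wpM2l p0 inB) (ler_wpM2l _ outB)) _.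
  by rewrite subr_ge0.
set A := t ^+ \rank W; set B := h ^+ #|X'|.
have AB0 : 0 <= A * B by rewrite mulr_ge0 ?exprn_ge0.
have -> : p * (h * (t * A * B)) + (1 - p) * (A * B) =
  (p * t * h + (1 - p)) * (A * B) by ring.
have -> : A * (h * B) = h * (A * B) by ring.
rewrite ler_wpM2r //.
apply: le_trans (_ : p * t * 1 + (1 - p) <= _); last by rewrite /h mulr1 addrC.
by rewrite lerD2r ler_wpM2l // mulr_ge0.
Qed.


Definition Prob X (Q : pred {set T}) : R := Esub X (fun E => (Q E)%:R).

Lemma Prob_le X (Q Q' : pred {set T}) :
  (forall E, E \subset X -> Q E -> Q' E) -> Prob X Q <= Prob X Q'.
Proof.
move=> QQ'; apply: ler_Esub => E EX; rewrite ler_nat.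
by case QE: (Q E) => //; rewrite QQ'.
Qed.

Lemma Prob_le1 X (Q : pred {set T}) : Prob X Q <= 1.
Proof.
by rewrite -[leRHS](Esub_cst X); apply: ler_Esub => E _; case: (Q E); rewrite ?ler01.
Qed.

Lemma Prob_ge0 X (Q : pred {set T}) : 0 <= Prob X Q.
Proof. by rewrite -[leLHS](Esub_cst X); apply: ler_Esub => E _; rewrite ler0n. Qed.

Lemma Prob_complement X (Q Q' : pred {set T}) :
  (forall E, E \subset X -> ~~ Q E -> Q' E) -> 1 - Prob X Q' <= Prob X Q.
Proof.
move=> QQ'; rewrite lerBlDr -EsubD -[leLHS](Esub_cst X); apply: ler_Esub => E EX.
rewrite /= -natrD (ler_nat _ 1); have := QQ' E EX.
by case: (Q E) => [_|/(_ isT) ->].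
Qed.

Lemma Prob_or X (Q Q' : pred {set T}) :
  Prob X (fun E => Q E || Q' E) <= Prob X Q + Prob X Q'.
Proof.
rewrite -EsubD; apply: ler_Esub => E _.
by rewrite /= -natrD ler_nat; case: (Q E); case: (Q' E).
Qed.

Lemma Prob_exists (I : finType) (A : pred I) X (Q : I -> pred {set T}) :
  Prob X (fun E => [exists i, A i && Q i E]) <= \sum_(i | A i) Prob X (Q i).
Proof.
rewrite -Esub_sum; apply: ler_Esub => E _.
case: existsP => [[i /andP[Ai Qi]]|_]; last by apply: sumr_ge0 => i _; rewrite ler0n.
by rewrite (bigD1 i) //= Qi lerDl sumr_ge0 // => j _; rewrite ler0n.
Qed.

Lemma Prob_markov X (Q : pred {set T}) (c : R) f :
  (forall E, 0 <= f E) -> (forall E, E \subset X -> Q E -> c <= f E) ->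
  c * Prob X Q <= Esub X f.
Proof.
move=> f0 cf; rewrite -EsubZ; apply: ler_Esub => E EX.
by case QE: (Q E); rewrite ?mulr1 ?mulr0 ?f0 // cf.
Qed.

(** Markov's inequality for the weight in [Esub_span_le]: both bases are at most 1, so bounded
    exponents keep the weight large on the event. *)
Lemma Prob_span_le (K : fieldType) (q : nat) (r : T -> 'rV[K]_q) (t : R)
    (X : {set T}) (W : 'M[K]_q) (k m : nat) (h := 1 - p + p * t) :
  0 < t <= 1 ->
  (forall E, \rank (W + \sum_(e in E) << r e >>)%MS <= \rank W + k)%N ->
  t ^+ k * h ^+ m * Prob X (fun E =>
    (#|[set e in X | (r e <= W + \sum_(e in E) << r e >>)%MS]| <= m)%N) <= h ^+ #|X|.
Proof.
move=> /andP[t0 t1] rk; case/andP: (p01) => p0 p1.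
have h0 : 0 <= h by rewrite addr_ge0 ?subr_ge0 ?mulr_ge0 // ltW.
have h1 : h <= 1 by rewrite /h -[leRHS](subrK p) lerD2l ler_piMr.
have tW : 0 < t ^+ \rank W by rewrite exprn_gt0.
rewrite -(ler_pM2l tW) mulrA mulrA -exprD.
apply: le_trans (Esub_span_le r X W _); last by rewrite ltW.
apply: Prob_markov => [E|E _ le_m]; first by rewrite mulr_ge0 ?exprn_ge0 // ltW.
by rewrite ler_pM ?exprn_ge0 ?ler_wiXn2l // ltW.
Qed.

End RandomSubset.

Lemma sum_subsets_expr (R : comPzRingType) (T : finType) (z : R) :
  \sum_(U : {set T}) z ^+ #|U| = (z + 1) ^+ #|T|.
Proof.
rewrite -prodr_const (bigA_distr _ _ (fun=> z) (fun=> 1)); apply: eq_bigr => U _.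
by rewrite -big_mkcond /= prodr_const.
Qed.

(** * Existence of generic embeddings *)

Section MuniEval.
Variables (R : comNzRingType) (n : nat).

(** The general target serves twice: with scalars in [meval_muni], and with [mwiden] and the last
    indeterminate in [muni_neq0], where it recovers [q]. *)
Lemma horner_muni (S : comNzRingType) (f : {rmorphism {mpoly R[n]} -> S}) (t : S)
    (q : {mpoly R[n.+1]}) :
  (map_poly f (muni q)).[t] =
  \sum_(m <- msupp q) f (q@_m)%:MP *
     \prod_(i < n) f 'X_i ^+ m (widen_ord (leqnSn n) i) * t ^+ m ord_max.
Proof.
rewrite muniE rmorph_sum horner_sum; apply: eq_bigr => m _.
rewrite /= map_polyZ map_polyXn hornerZ hornerXn -mul_mpolyC rmorphM; congr (_ * _ * _).
rewrite mpolyXE_id rmorph_prod; apply: eq_bigr => i _.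
by rewrite rmorphXn mnmE.
Qed.

Lemma meval_muni (q : {mpoly R[n.+1]}) (x : 'I_n.+1 -> R) :
  q.@[x] =
  (map_poly (meval (fun i => x (widen_ord (leqnSn n) i))) (muni q)).[x ord_max].
Proof.
rewrite horner_muni mevalE; apply: eq_bigr => m _.
rewrite big_ord_recr /= mevalC mulrA; congr (_ * _ * _).
by apply: eq_bigr => i _; rewrite mevalXU.
Qed.

Lemma muni_neq0 (q : {mpoly R[n.+1]}) : q != 0 -> muni q != 0.
Proof.
apply: contraNneq => q0; apply/eqP.
have := horner_muni (@mwiden n R) 'X_ord_max q.
rewrite q0 map_poly0 horner0 => ->; rewrite [LHS]mpolyE.
apply: eq_bigr => m _; rewrite /= -mul_mpolyC mwidenC -mulrA; congr (_ * _).
rewrite mpolyXE_id big_ord_recr /=; congr (_ * _).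
by apply: eq_bigr => i _; rewrite mwidenX mnmwiden1.
Qed.

End MuniEval.

Section GenericExists.
Variable R : realType.

(** Countably many finite root sets have Lebesgue measure zero, so they do not cover the line. *)
Lemma exists_nonroot (I : countType) (r : I -> {poly R}) :
  (forall i, r i != 0) -> exists t, forall i, ~~ root (r i) t.
Proof.
move=> r0; pose A := (\bigcup_(i in [set: I]) [set t : R | root (r i) t])%classic.
have cA : countable A.
  apply: bigcup_countable => // i _; apply: finite_set_countable.
  apply: contrapT => /(@infinite_set_fset _ _ (size (r i))) [X XA sX].
  have := @max_poly_roots _ (r i) (finmap.enum_fset X) (r0 i) _ (finmap.fset_uniq X).
  rewrite ltnNge sX => H; suff : false by []; apply: H.
  by apply/allP => t tX; apply: XA.
have : A != [set: R]%classic.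
  apply/eqP => AT; have := countable_lebesgue_measure0 cA; rewrite AT.
  have := @lebesgue_measure_itv R `]-oo, +oo[; rewrite set_itvNyy => ->.
  by [].
move/eqP => nA; apply: contrapT => none; apply: nA; apply/seteqP; split=> // t _.
apply: contrapT => tA; apply: none; exists t => i; apply/negP=> rt; apply: tA.
by exists i.
Qed.

(** Induction on the variables: first avoid the zeros of all leading coefficients in the last
    variable, then the roots of the resulting univariate polynomials. *)
Lemma exists_nonzero (I : countType) (n : nat) (q : I -> {mpoly R[n]}) :
  (forall i, q i != 0) -> exists x, forall i, (q i).@[x] != 0.
Proof.
elim: n q => [|n IHn] q q0.
  exists (fun=> 0) => i; have := q0 i.
  have -> : q i = ((q i)@_0%MM)%:MP.
    apply/mpolyP=> m; rewrite mcoeffC; have -> : m = 0%MM by apply/mnmP=> -[].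
    by rewrite eqxx mulr1.
  by rewrite mevalC mpolyC_eq0.
have lc0 i : lead_coef (muni (q i)) != 0 by rewrite lead_coef_eq0 muni_neq0.
have [x xP] := IHn _ lc0.
pose r i := map_poly (meval x) (muni (q i)).
have r0 i : r i != 0.
  apply/eqP => /(congr1 (fun s : {poly R} => s`_(size (muni (q i))).-1)).
  by rewrite coef_map coef0; apply/eqP/xP.
have [t tP] := exists_nonroot r0.
pose y (i : 'I_n.+1) := oapp x t (insub (i : nat)).
exists y => i; rewrite meval_muni.
have -> : y ord_max = t by rewrite /y insubF //= ltnn.
have -> : map_poly (meval (fun k => y (widen_ord (leqnSn n) k))) (muni (q i)) = r i.
  apply/polyP=> k; rewrite !coef_map; apply: meval_eq => j.
  by rewrite /y /= valK.
exact: tP.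
Qed.

Lemma exists_alg_indep (N : nat) : exists x : 'I_N -> R,
  forall q : {mpoly rat[N]}, q != 0 -> (map_mpoly (ratr : rat -> R) q).@[x] != 0.
Proof.
(* Lists of monomials with rational coefficients form a countable index type reaching every rational
   polynomial; lists that sum to zero are sent to 1. *)
pose dec (s : seq ('X_{1..N} * rat)) : {mpoly rat[N]} := \sum_(c <- s) c.2 *: 'X_[c.1].
pose Q s : {mpoly R[N]} :=
  if dec s == 0 then 1 else map_mpoly (ratr : rat -> R) (dec s).
have map_neq0 (q : {mpoly rat[N]}) : q != 0 -> map_mpoly (ratr : rat -> R) q != 0.
  apply: contraNneq => q0; apply/eqP/mpolyP => m.
  have := congr1 (mcoeff m) q0; rewrite mcoeff_map_mpoly !mcoeff0 => /eqP.
  by rewrite fmorph_eq0 => /eqP.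
have Q0 s : Q s != 0.
  rewrite /Q; case: (eqVneq (dec s)) => [_|nz]; first exact: oner_neq0.
  exact: map_neq0.
have [x xP] := exists_nonzero Q0; exists x => q q0.
have := xP [seq (m, q@_m) | m <- msupp q].
rewrite /Q; have -> : dec [seq (m, q@_m) | m <- msupp q] = q.
  by rewrite /dec big_map /= -mpolyE.
by rewrite (negPf q0).
Qed.

End GenericExists.

(** * Tail bounds *)

Section Bridge.
Variables (R : realType) (n d : nat).
Implicit Types (P : 'M[R]_(n, d)) (E : {set 'I_n * 'I_n}).

Lemma exists_generic : exists P, generic P.
Proof.
have [x xP] := exists_alg_indep R (n * d).
exists (vec_mx (\row_i x i)) => q q0.
rewrite (meval_eq (v2 := x)) ?xP // => i.
by rewrite vec_mxK mxE.
Qed.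

Lemma rank_rigidity_matrix P E : E \subset all_pairs n ->
  \rank (rigidity_matrix E P) = \rank (edge_span P E).
Proof.
move=> /subsetP Elt; rewrite -edge_mxE; congr (\rank _); apply/row_matrixP=> i.
rewrite !rowK; congr mxvec; apply/matrixP=> v k; rewrite !mxE.
have := Elt _ (enum_valP i); rewrite inE; move: (enum_val i) => u /= lt.
case: (eqVneq v u.1) => [->|_].
  by rewrite (_ : (u.1 == u.2) = false) ?subr0 ?mul1r //; apply: ltn_eqF.
case: (eqVneq v u.2) => _; first by rewrite sub0r mulN1r opprB.
by rewrite subrr mul0r.
Qed.

(** Transfer in both directions makes the rank the same at all generic embeddings. *)
Lemma d_rigid_generic P E : generic P -> (d < n)%N -> E \subset all_pairs n ->
  \rank (edge_span P E) = (d * n - 'C(d.+1, 2))%N -> @d_rigid R d n E.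
Proof.
move=> genP dn Elt rk; split=> // P' genP'.
rewrite rank_rigidity_matrix // -rk; apply/eqP; rewrite eqn_leq.
by rewrite !edge_span_transfer.
Qed.

(** Since [d_rigid] quantifies over generic embeddings, drawing a consequence from it takes an
    actual one. *)
Lemma d_rigid_card_ge E : E \subset all_pairs n -> @d_rigid R d n E ->
  (d < n)%N /\ (d * n - 'C(d.+1, 2) <= #|E|)%N.
Proof.
move=> Elt [dn rk]; split=> //; have [P /rk <-] := exists_generic.
exact: rank_leq_row.
Qed.

End Bridge.

Lemma Gnp_probE (R : realType) (n : nat) (p : R) (Q : {set 'I_n * 'I_n} -> Prop) :
  Gnp_prob p Q = Prob p (all_pairs n) (fun E => `[< Q E >]).
Proof. by apply: eq_bigr => E _; case: asbool. Qed.

Section Tails.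
Variables (R : realType) (T : finType) (p : R).
Hypothesis p01 : 0 <= p <= 1.
Implicit Types (X Y E : {set T}).

Lemma expr_le_expR (t : R) (N : nat) : 0 <= t ->
  (1 - p + p * t) ^+ N <= expR (p * (t - 1) * N%:R).
Proof.
case/andP: p01 => p0 p1 t0.
have -> : 1 - p + p * t = 1 + p * (t - 1) by ring.
rewrite expRM_natr lerXn2r ?nnegrE ?expR_ge0 ?expR_ge1Dx //.
have -> : 1 + p * (t - 1) = 1 - p + p * t by ring.
by rewrite addr_ge0 ?subr_ge0 ?mulr_ge0.
Qed.

(** Both tails at once: the sign of [L] decides whether the hypothesis bounds [#|E :&: Y|] from
    below or from above. *)
Lemma chernoff X Y (Q : pred {set T}) (L y : R) :
  (forall E, E \subset X -> Q E -> L * y <= L * #|E :&: Y|%:R) ->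
  Prob p X Q <= expR (p * (expR L - 1) * #|X :&: Y|%:R - L * y).
Proof.
move=> QL; rewrite expRB ler_pdivlMr ?expR_gt0 // mulrC.
apply: le_trans (expr_le_expR _ (expR_ge0 L)).
rewrite -(Esub_expr p X Y); apply: Prob_markov; [by []|move=> E|move=> E EX QE].
  by rewrite exprn_ge0 // expR_ge0.
by rewrite -expRM_natr ler_expR QL.
Qed.

(** [Prob_span_le] at [t = expR (- L)]: [k] units of rank cost [L] each, and the surplus power of
    [h] is bounded by [expr_le_expR]. *)
Lemma Prob_span_le_expR (K : fieldType) (q : nat) (r : T -> 'rV[K]_q) (L : R)
    X (W : 'M[K]_q) (k m : nat) :
  0 <= L -> (m <= #|X|)%N ->
  (forall E, \rank (W + \sum_(e in E) << r e >>)%MS <= \rank W + k)%N ->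
  Prob p X (fun E => (#|[set e in X | (r e <= W + \sum_(e in E) << r e >>)%MS]| <= m)%N)
  <= expR (L * k%:R - p * (1 - expR (- L)) * (#|X| - m)%:R).
Proof.
move=> L0 mX rk; case/andP: (p01) => p0 p1.
set Q := fun E => _.
have t01 : 0 < expR (- L) <= 1 by rewrite expR_gt0 expR_le1 oppr_le0.
have [t0 t1] := andP t01.
have := Prob_span_le p01 X m t01 rk; set h := 1 - p + p * _.
have ht : expR (- L) <= h.
  rewrite -subr_ge0 (_ : _ - _ = (1 - p) * (1 - expR (- L))); last by rewrite /h; ring.
  by rewrite mulr_ge0 // subr_ge0.
have h0 : 0 < h := lt_le_trans t0 ht.
rewrite -ler_pdivlMl ?mulr_gt0 ?exprn_gt0 // => /le_trans; apply.
rewrite -{1}(subnKC mX) exprD invfM.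
rewrite [leLHS]mulrA mulfVK ?gt_eqF ?exprn_gt0 //.
rewrite expRD ler_pM ?invr_ge0 ?exprn_ge0 ?(ltW t0) ?(ltW h0) //.
  by rewrite -expRM_natr -expRN mulNr opprK.
apply: le_trans (expr_le_expR _ (ltW t0)) _.
by rewrite ler_expR -mulNr -mulrN opprB.
Qed.

End Tails.

Section ExpLog.
Variable R : realType.

Lemma ln2_lt1 : ln 2 < 1 :> R.
Proof.
rewrite -ltr_expR lnK ?posrE ?ltr0n //.
by have := @expR_gt1Dx R 1 (oner_neq0 _); rewrite -(natrD _ 1 1).
Qed.

Lemma ln2_gt0 : 0 < ln 2 :> R.
Proof. by rewrite ln_gt0 // ltr1n. Qed.

Lemma expR_sub1_le (x : R) : 0 <= x <= 1 / 2 -> expR x - 1 <= 2 * x.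
Proof.
move=> /andP[x0 x1]; have h := expR_ge1Dx (- x).
have px : 0 < 1 - x by lra.
have : expR x <= (1 - x)^-1.
  by rewrite -[leLHS]invrK lef_pV2 ?posrE ?invr_gt0 ?expR_gt0 // -expRN.
have : (1 - x)^-1 <= 1 + 2 * x; last by lra.
rewrite -[leLHS]mul1r ler_pdivrMr //; nra.
Qed.

End ExpLog.

(** * Failure probabilities at a fixed [n] below the threshold *)

Section FiniteN.
Variables (R : realType) (n d : nat) (p : R).
Hypotheses (p01 : 0 <= p <= 1) (d_lt_n : (d < n)%N).
Local Notation Pr := (Prob p (all_pairs n)).

(** Chernoff with [L = - ln 2], suited to half the mean: for [y] near [n * p / 2] the exponent is
    about [- (1 - ln 2) / 2 * n * p], which is the source of the constant [2 / (1 - ln 2)]. *)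
Lemma Prob_low_degree (v : 'I_n) (y : R) :
  Pr (fun E => #|E :&: incident v|%:R <= y) <=
  expR (y * ln 2 - p / 2 * n.-1%:R).
Proof.
apply: le_trans (chernoff p01 (Y := incident v) (L := - ln 2) (y := y) _) _.
  by move=> E _ le_y; rewrite !mulNr lerN2 ler_wpM2l // ltW // ln2_gt0.
rewrite card_all_pairs_incident ler_expR expRN lnK ?posrE ?ltr0n //.
by rewrite [leLHS](_ : _ = y * ln 2 - p / 2 * n.-1%:R) //; field.
Qed.

Lemma Prob_dense_subset (U : {set 'I_n}) (L y : R) : 0 <= L ->
  Pr (fun E => y <= #|E :&: pairs_in U|%:R) <=
  expR (p * expR L * (#|U| ^ 2)%:R / 2 - L * y).
Proof.
move=> L0; case/andP: p01 => p0 p1.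
apply: le_trans (chernoff p01 (Y := pairs_in U) (L := L) (y := y) _) _.
  by move=> E _ le_y; rewrite ler_wpM2l.
rewrite ler_expR lerD2r.
have cU : (#|all_pairs n :&: pairs_in U|%:R : R) <= (#|U| ^ 2)%:R / 2.
  by rewrite ler_pdivlMr ?ltr0n // mulrC -natrM ler_nat card_all_pairs_in.
have e1 : 1 <= expR L by rewrite -expR0 ler_expR.
have -> : p * expR L * (#|U| ^ 2)%:R / 2 = p * (expR L * ((#|U| ^ 2)%:R / 2)) by ring.
rewrite -mulrA ler_wpM2l // ler_pM ?subr_ge0 ?ler0n //.
by rewrite gerBl ler01.
Qed.

(** Over the complete graph on [A], whose rank is known by [clique_rank], each of the other
    [n - #|A|] vertices leaves room for at most [d] more units of rank. *)
Lemma Prob_small_span (P : 'M[R]_(n, d)) (A : {set 'I_n}) (L : R) (m : nat) :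
  generic P -> 0 <= L -> (m <= #|all_pairs n|)%N ->
  Pr (fun E => (#|span_over P A E| <= m)%N) <=
  expR (L * (d * (n - #|A|))%:R - p * (1 - expR (- L)) * (#|all_pairs n| - m)%:R).
Proof.
move=> genP L0 mX.
apply: (Prob_span_le_expR p01 (r := fun u => edge_row P u.1 u.2)
  (W := edge_span P (pairs_in A)) L0 mX) => E.
rewrite -[X in \rank (_ + X)%MS]/(edge_span P E) -edge_spanU.
apply: leq_trans (edge_span_rank_ub d_lt_n _ genP) _.
rewrite (clique_rank genP d_lt_n).
have An : (#|A| <= n)%N by rewrite -[n in leqRHS]card_ord max_card.
have := sum_minn (ltnW d_lt_n); rewrite (big_cat_nat (leq0n _) An) /=.
have : (\sum_(#|A| <= i < n) minn d i <= d * (n - #|A|))%N.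
  rewrite mulnC -sum_nat_const_nat; apply: leq_sum => i _; exact: geq_minl.
by move=> h1 h2; rewrite leq_subLR -h2 addnC !leq_add2l.
Qed.

Variables (eps eta : R) (D : nat).
Hypotheses (eps0 : 0 < eps) (eps1 : eps < 1 / 2).
(* In sum_dense_subset the Chernoff parameter is L = 8 / eps, and eta is such
   that exp L * eta / 2 = 1 stays below L * eps / 4 = 2. *)
Hypothesis etaE : eta = 2 * expR (- (8 / eps)).
Hypothesis d_lt : d%:R < (1 / 2 - eps) * n%:R * p.
Hypothesis np_ge : 2 / (1 - ln 2) * ln n%:R <= n%:R * p.
Hypotheses (D0 : (0 < D)%N) (dD : (d <= D)%N).
Hypothesis D_small : (4 * D + (d ^ 2 * n ^ 2) %/ D ^ 2)%:R <= eps * eta / 2 * n%:R.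
Hypothesis n_large : 4 <= eps * eta * n%:R.
Hypothesis np_large : 2 <= eps ^+ 2 * eta / 8 * (n%:R * p).

Lemma eta_bounds : 0 < eta <= 2.
Proof.
rewrite etaE mulr_gt0 ?expR_gt0 //= ler_piMr // expR_le1 oppr_le0 divr_ge0 //.
exact: ltW.
Qed.

Let n2 : (1 < n)%N.
Proof.
rewrite ltnNge; apply/negP=> n1; have /andP[h0 h2] := eta_bounds.
have n1' : n%:R <= 1 :> R by rewrite -[leRHS]/(1%:R) ler_nat.
have h : eps * eta <= 1 / 2 * 2 by rewrite ler_pM // ltW.
have : eps * eta * n%:R <= 1 / 2 * 2 * 1 by rewrite ler_pM // mulr_ge0 // ltW.
by move: n_large; lra.
Qed.

Let np_ge2 : 2 * ln n%:R <= n%:R * p.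
Proof.
apply: le_trans np_ge; have l1 := ln2_lt1 R; have l0 := ln2_gt0 R.
have n0 : 0 <= ln (n%:R : R) by rewrite ln_ge0 // ler1n ltnW.
rewrite ler_wpM2r // -[leLHS]mulr1 ler_wpM2l // invf_ge1 ?subr_gt0 //.
by rewrite gerBl ltW.
Qed.

Lemma sum_low_degree (k : nat) : k%:R <= eps / 2 * (n%:R * p) ->
  \sum_(v : 'I_n) Pr (fun E => (#|E :&: incident v| < d + k)%N) <=
  expR 1 * expR (- (eps * ln 2 * ln n%:R)).
Proof.
move=> kle; have l1 := ln2_lt1 R; have l0 := ln2_gt0 R.
case/andP: p01 => p0 p1.
have bound v : Pr (fun E => (#|E :&: incident v| < d + k)%N) <=
    expR (1 - ln n%:R - eps * ln 2 * ln n%:R).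
  pose y := (1 / 2 - eps / 2) * (n%:R * p).
  apply: le_trans (_ : Pr (fun E => #|E :&: incident v|%:R <= y) <= _).
    apply: Prob_le => // E _ h; apply: le_trans (_ : (d + k)%:R <= _).
      by rewrite ler_nat ltnW.
    by rewrite natrD /y; move: d_lt kle; nra.
  apply: le_trans (Prob_low_degree _ _) _; rewrite ler_expR /y.
  have -> : n.-1%:R = n%:R - 1 :> R by rewrite -subn1 natrB // ltnW.
  (* The assumed constant gives exactly the [ln n] consumed by the union bound over vertices; the
     margin [eps] then gives the decay in [h2]. *)
  have h1 : ln n%:R <= n%:R * p * ((1 - ln 2) / 2).
    rewrite -ler_pdivrMr; last by rewrite divr_gt0 // subr_gt0.
    by rewrite invf_div mulrC.
  have h2 : eps * ln 2 * ln n%:R <= n%:R * p * (eps / 2 * ln 2).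
    have e2 : 0 <= eps * ln 2 / 2 by rewrite divr_ge0 // mulr_ge0 // ltW.
    have := ler_wpM2r e2 np_ge2; lra.
  by lra.
apply: le_trans (ler_sum _ (fun v _ => bound v)) _.
rewrite sumr_const card_ord -[leLHS]mulr_natl.
have nE : expR (ln n%:R) = n%:R :> R by rewrite lnK // posrE ltr0n ltnW.
apply: le_trans (_ : expR (ln n%:R) * expR (1 - ln n%:R - eps * ln 2 * ln n%:R) <= _).
  by rewrite nE.
by rewrite -!expRD ler_expR; lra.
Qed.

(** Each term is at most [z ^+ #|U|] with [z] the inverse square of [n], so the sum over nonempty
    sets is at most [(z + 1) ^+ n - 1], in turn at most [expR (1 / n) - 1]. *)
Lemma sum_dense_subset (b k : nat) :
  b%:R <= eta * n%:R -> eps / 2 * (n%:R * p) <= k.+1%:R ->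
  \sum_(U : {set 'I_n} | (U != set0) && (#|U| <= b)%N)
     Pr (fun E => (#|U| * k.+1 <= 2 * #|E :&: pairs_in U|)%N) <= 2 / n%:R.
Proof.
move=> bn kge; case/andP: p01 => p0 p1.
set z := expR (- (2 * ln n%:R)) : R.
have n0 : 0 < n%:R :> R by rewrite ltr0n ltnW.
have zE : z = (n%:R ^+ 2)^-1.
  by rewrite /z expRN expRM_natl lnK.
have bound (U : {set 'I_n}) : (#|U| <= b)%N ->
    Pr (fun E => (#|U| * k.+1 <= 2 * #|E :&: pairs_in U|)%N) <= z ^+ #|U|.
  move=> Ub; set u := #|U| in Ub *.
  pose y : R := u%:R * k.+1%:R / 2.
  apply: le_trans (_ : Pr (fun E => y <= #|E :&: pairs_in U|%:R) <= _).
    apply: Prob_le => // E _ h; rewrite /y ler_pdivrMr // -!natrM ler_nat.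
    by rewrite [leqRHS]mulnC.
  have L0 : 0 <= 8 / eps by rewrite divr_ge0 // ltW.
  apply: le_trans (Prob_dense_subset _ _ L0) _; rewrite -/u /z -expRM_natr ler_expR.
  have u0 : 0 <= u%:R :> R by [].
  have uN : u%:R <= eta * n%:R by apply: le_trans bn; rewrite ler_nat.
  have ee : expR (8 / eps) * eta = 2 by rewrite etaE mulrCA -expRD subrr expR0 mulr1.
  have h1 : p * expR (8 / eps) * (u ^ 2)%:R / 2 <= u%:R * (n%:R * p).
    apply: le_trans (_ : p * expR (8 / eps) * (u%:R * (eta * n%:R)) / 2 <= _).
      rewrite ler_wpM2r ?invr_ge0 // ler_wpM2l ?mulr_ge0 ?expR_ge0 //.
      by rewrite natrX expr2 ler_wpM2l.
    rewrite [leLHS](_ : _ = p * u%:R * n%:R / 2 * (expR (8 / eps) * eta)); last by ring.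
    by rewrite ee; lra.
  have h2 : 2 * (u%:R * (n%:R * p)) <= 8 / eps * y.
    have -> : 8 / eps * y = 4 / eps * u%:R * k.+1%:R.
      by rewrite /y; field; rewrite gt_eqF.
    have -> : 2 * (u%:R * (n%:R * p)) = 4 / eps * u%:R * (eps / 2 * (n%:R * p)).
      by field; rewrite gt_eqF.
    by rewrite ler_wpM2l // mulr_ge0 // divr_ge0 // ltW.
  have h3 : u%:R * (2 * ln n%:R) <= u%:R * (n%:R * p) by rewrite ler_wpM2l.
  by lra.
apply: le_trans (_ : \sum_(U : {set 'I_n} | (U != set0) && (#|U| <= b)%N) z ^+ #|U| <= _).
  by apply: ler_sum => U /andP[_]; apply: bound.
have z0 : 0 <= z := expR_ge0 _.
apply: le_trans (_ : \sum_(U : {set 'I_n} | U != set0) z ^+ #|U| <= _).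
  rewrite big_mkcondr /=; apply: ler_sum => U _; case: ifP => // _.
  by rewrite exprn_ge0.
have -> : \sum_(U : {set 'I_n} | U != set0) z ^+ #|U| = (z + 1) ^+ n - 1.
  rewrite -[in RHS](card_ord n) -sum_subsets_expr [in RHS](bigD1 set0) //= cards0 expr0.
  by rewrite addrAC subrr add0r.
have nz : n%:R * z = n%:R^-1 by rewrite zE expr2; field; rewrite gt_eqF.
apply: le_trans (_ : expR (n%:R^-1) - 1 <= _).
  rewrite lerD2r -nz expRM_natl lerXn2r ?nnegrE ?addr_ge0 ?expR_ge0 //.
  by rewrite addrC expR_ge1Dx.
apply: expR_sub1_le; rewrite invr_ge0 ltW //= ler_pdivlMr // mulrC ler_pdivrMr //.
by rewrite mul1r ler_nat.
Qed.

Lemma sum_small_span (P : 'M[R]_(n, d)) (b : nat) : generic P ->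
  eta * n%:R <= b.+1%:R ->
  \sum_(A : {set 'I_n} | (#|A| + b < n)%N)
     Pr (fun E => (2 * #|span_over P A E| <=
                   n * (#|A| + 4 * D + (d ^ 2 * n ^ 2) %/ D ^ 2))%N)
  <= expR (- n%:R).
Proof.
move=> genP etab; case/andP: p01 => p0 p1.
have /andP[eta0 eta2] := eta_bounds.
have n0 : 0 < n%:R :> R by rewrite ltr0n ltnW.
set S := (4 * D + (d ^ 2 * n ^ 2) %/ D ^ 2)%N.
have S_le : S%:R <= eps * eta / 2 * n%:R := D_small.
have bound (A : {set 'I_n}) : (#|A| + b < n)%N ->
    Pr (fun E => (2 * #|span_over P A E| <=
                  n * (#|A| + 4 * D + (d ^ 2 * n ^ 2) %/ D ^ 2))%N)
    <= expR (- (2 * n%:R)).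
  move=> Ab; rewrite -addnA -/S; set a := #|A| in Ab *.
  have an : (a <= n)%N by apply: leq_trans (ltnW Ab); rewrite leq_addr.
  pose w : R := (n - a)%:R.
  have wE : w = n%:R - a%:R by rewrite /w natrB.
  have w_ge : eta * n%:R <= w.
    by apply: le_trans etab _; rewrite ler_nat leq_subRL // addnS.
  have S0 : 0 <= S%:R :> R by [].
  have eta_n : 8 <= eta * n%:R.
    have : eps * (eta * n%:R) <= 1 / 2 * (eta * n%:R).
      by rewrite ler_wpM2r ?ltW // mulr_gt0.
    by move: n_large; rewrite -mulrA; lra.
  have S_small : S%:R <= w - 1 :> R.
    have : eps * (eta * n%:R) <= 1 / 2 * (eta * n%:R).
      by rewrite ler_wpM2r ?ltW // mulr_gt0.
    by move: S_le w_ge eta_n; lra.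
  pose m := (n * (a + S))./2.
  have mX : (n * (a + S) <= 2 * #|all_pairs n|)%N.
    rewrite card_all_pairs leq_mul2l; apply/orP; right.
    rewrite -(ler_nat R) natrD -subn1 natrB ?(ltnW n2) //.
    by move: S_small; rewrite wE; lra.
  have mN : (m <= #|all_pairs n|)%N.
    by rewrite /m leq_half_double -mul2n leqW.
  apply: le_trans (_ : Pr (fun E => (#|span_over P A E| <= m)%N) <= _).
    by apply: Prob_le => // E _; rewrite /m geq_half_double mul2n.
  (* With [L = eps] the rank costs less than [eps * (1 / 2 - eps) * n * p * w], whereas the roughly
     [n * w / 2] pairs left unspanned gain at least [eps * (1 - eps) * p] each. *)
  apply: le_trans (Prob_small_span A genP (ltW eps0) mN) _; rewrite ler_expR.
  rewrite natrM -/a -/w.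
  set q := 1 - expR (- eps); set T := (#|all_pairs n| - m)%:R.
  have q_ge : eps * (1 - eps) <= q.
    have e1 := expR_ge1Dx eps.
    have : expR (- eps) <= (1 + eps)^-1.
      by rewrite expRN lef_pV2 ?posrE ?expR_gt0 // addr_gt0.
    have : (1 + eps)^-1 <= 1 - eps * (1 - eps).
      rewrite -[leLHS]mul1r ler_pdivrMr ?addr_gt0 //.
      have : 0 <= eps ^+ 3 by rewrite exprn_ge0 // ltW.
      by move=> e3; rewrite [leRHS](_ : _ = 1 + eps ^+ 3); [lra | ring].
    by rewrite /q; lra.
  have T_ge : n%:R * (w - 1 - S%:R) / 2 <= T.
    rewrite ler_pdivrMr // wE.
    have -> : T = #|all_pairs n|%:R - m%:R by rewrite /T natrB.
    have h1 : 2 * m%:R <= n%:R * (a%:R + S%:R) :> R.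
      by rewrite -natrD -!natrM ler_nat /m mul2n -geq_half_double.
    have h2 : 2 * #|all_pairs n|%:R = n%:R * (n%:R - 1) :> R.
      by rewrite -natrM card_all_pairs natrM -subn1 natrB // ltnW.
    by move: h1 h2; lra.
  have q0 : 0 <= eps * (1 - eps).
    by apply: mulr_ge0; [exact: ltW | move: eps1; lra].
  have Z0 : 0 <= n%:R * (w - 1 - S%:R) / 2.
    by rewrite divr_ge0 // mulr_ge0 // subr_ge0.
  have h1 : p * (eps * (1 - eps)) * (n%:R * (w - 1 - S%:R) / 2) <= p * q * T.
    by apply: ler_pM => //; [exact: mulr_ge0 | exact: ler_wpM2l].
  have w0 : 0 <= w by [].
  have h2 : eps * (d%:R * w) <= eps * ((1 / 2 - eps) * n%:R * p * w).
    by apply: ler_wpM2l; [exact: ltW | apply: ler_wpM2r => //; exact: ltW].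
  have np0 : 0 <= eps * (n%:R * p) by rewrite mulr_ge0 ?mulr_ge0 // ltW.
  (* The terms [w / 2] cancel; what remains, [- eps * w / 2], absorbs [S] and the rounding with room
     to spare. *)
  have key : (1 / 2 - eps) * w - (1 - eps) * (w - 1 - S%:R) / 2 <= - (eps * eta * n%:R / 8).
    have k1 : eps * (eta * n%:R) <= eps * w by rewrite ler_wpM2l // ltW.
    by move: S_le n_large k1; nra.
  have h3 := ler_wpM2l np0 key.
  have h4 : 2 * n%:R <= n%:R * (eps ^+ 2 * eta / 8 * (n%:R * p)).
    by rewrite mulrC ler_wpM2l.
  by move: h1 h2 h3 h4; rewrite expr2; lra.
(* A union bound over all [2 ^ n] sets: [2 < expR 1] uses up only half of the exponent. *)
apply: le_trans (_ : \sum_(A : {set 'I_n}) expR (- (2 * n%:R)) <= _).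
  rewrite big_mkcond /=; apply: ler_sum => A _; case: ifP => [/bound //|_].
  exact: expR_ge0.
have -> : \sum_(A : {set 'I_n}) expR (- (2 * n%:R)) = 2 ^+ n * expR (- (2 * n%:R)) :> R.
  move: (expR _) => c.
  rewrite -[in RHS](card_ord n) -[2]/(1 + 1) -sum_subsets_expr mulr_suml.
  by apply: eq_bigr => A _; rewrite expr1n mul1r.
have -> : - n%:R = n%:R + - (2 * n%:R) :> R by ring.
rewrite [leRHS]expRD ler_wpM2r ?expR_ge0 // -[X in expR X]mulr1 expRM_natl.
rewrite lerXn2r ?nnegrE ?expR_ge0 //.
by have := expR_ge1Dx (1 : R); rewrite -(natrD _ 1 1).
Qed.

Lemma Prob_rigid_ge :
  1 - Gnp_prob p (@d_rigid R d n) <=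
  expR 1 * expR (- (eps * ln 2 * ln n%:R)) + 2 / n%:R + expR (- n%:R).
Proof.
have [P genP] := exists_generic R n d; case/andP: p01 => p0 p1.
have /andP[eta0 eta2] := eta_bounds.
have etan0 : 0 <= eta * n%:R by rewrite mulr_ge0 // ltW.
have enp0 : 0 <= eps / 2 * (n%:R * p).
  by apply: mulr_ge0; [apply: divr_ge0 => //; exact: ltW | exact: mulr_ge0].
(* Rounding down is harmless: [#|A| + b < n] means at least [b.+1] missing vertices, hence more than
   [eta * n], and the sparsity bound involves [k.+1]. *)
pose b := Num.truncn (eta * n%:R); pose k := Num.truncn (eps / 2 * (n%:R * p)).
have /andP[b_le b_gt] := truncn_itv etan0; have /andP[k_le k_gt] := truncn_itv enp0.
pose Q1 (E : {set 'I_n * 'I_n}) := [exists v, true && (#|E :&: incident v| < d + k)%N].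
pose Q2 (E : {set 'I_n * 'I_n}) := [exists U : {set 'I_n},
  ((U != set0) && (#|U| <= b)%N) && (#|U| * k.+1 <= 2 * #|E :&: pairs_in U|)%N].
pose Q3 (E : {set 'I_n * 'I_n}) := [exists A : {set 'I_n}, (#|A| + b < n)%N &&
  (2 * #|span_over P A E| <= n * (#|A| + 4 * D + (d ^ 2 * n ^ 2) %/ D ^ 2))%N].
rewrite Gnp_probE.
apply: le_trans (Prob_complement p01 (Q := fun E => (Q1 E || Q2 E) || Q3 E) _) _.
  move=> E Elt; rewrite !negb_or => /andP[/andP[/existsPn q1 /existsPn q2] /existsPn q3].
  apply/asboolP/(d_rigid_generic genP d_lt_n Elt).
  apply: (rigidity_criterion genP d_lt_n Elt D0 dD (b := b) (k := k)).
  - by move=> v; have := q1 v; rewrite -leqNgt.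
  - by move=> U U0 Ub; have := q2 U; rewrite U0 Ub -ltnNge.
  - by move=> A Ab; have := q3 A; rewrite Ab -ltnNge.
apply: le_trans (Prob_or p01 _ _ _) (lerD _ _); last first.
  by apply: le_trans (Prob_exists p01 _ _ _) (sum_small_span genP (ltW b_gt)).
apply: le_trans (Prob_or p01 _ _ _) (lerD _ _).
  exact: le_trans (Prob_exists p01 _ _ _) (sum_low_degree k_le).
exact: le_trans (Prob_exists p01 _ _ _) (sum_dense_subset b_le (ltW k_gt)).
Qed.

End FiniteN.

(** * Too few edges *)

Section Flexible.
Variables (R : realType) (n d : nat) (p eps : R).
Hypotheses (p01 : 0 <= p <= 1) (eps0 : 0 < eps) (eps1 : eps < 1 / 2).
Hypothesis d_gt : (1 / 2 + eps) * n%:R * p < d%:R.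
Hypotheses (n_large : 2 <= eps * n%:R) (p_small : p <= eps / 4) (np_ge1 : 1 <= n%:R * p).

(** If [d] is small against [eps * n], the binomial is at most a fraction [eps / 2] of [d * n].
    Otherwise [d * n / 2] is quadratic in [n] and exceeds [n ^ 2 * p] because [p] is small. *)
Lemma rank_deficit : (d < n)%N ->
  (1 / 2 + eps / 2) * (n%:R * (n%:R * p)) <= (d * n - 'C(d.+1, 2))%:R.
Proof.
move=> dn.
have dn1 : d%:R + 1 <= n%:R :> R by rewrite natr1 ler_nat.
have C2 : 2 * 'C(d.+1, 2)%:R = d%:R * (d%:R + 1) :> R.
  rewrite natr1 -!natrM; congr (_%:R).
  by rewrite bin2 mul2n mulnC; apply: even_halfK; rewrite oddM /= andbN.
have Cle : ('C(d.+1, 2) <= d * n)%N.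
  rewrite -(ler_nat R) natrM.
  have : d%:R * (d%:R + 1) <= d%:R * n%:R :> R by rewrite ler_wpM2l.
  have : 0 <= d%:R * n%:R :> R by rewrite mulr_ge0.
  by lra.
rewrite natrB // natrM.
set x := n%:R * p; have x_ge1 : 1 <= x := np_ge1.
have n0 : 0 < n%:R :> R by apply: lt_le_trans dn1; rewrite ltr_wpDl.
have d_gt' : (1 / 2 + eps) * x < d%:R by rewrite /x mulrA.
have d0 : 0 <= d%:R :> R by [].
have [small|large] := lerP (d%:R + 1) (eps * n%:R).
  have h1 : d%:R * (d%:R + 1) <= d%:R * (eps * n%:R) by rewrite ler_wpM2l.
  have h2 : (1 / 2 + eps) * x * (n%:R * (1 - eps / 2)) <= d%:R * (n%:R * (1 - eps / 2)).
    apply: ler_wpM2r; last exact: ltW.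
    by apply: mulr_ge0; [exact: ltW | move: eps1; lra].
  have h3 : (1 / 2 + eps / 2) <= (1 / 2 + eps) * (1 - eps / 2).
    by move: eps0 eps1; nra.
  have h4 := ler_wpM2r (mulr_ge0 (ltW n0) (le_trans ler01 x_ge1)) h3.
  by lra.
have h1 : d%:R * (d%:R + 1) <= d%:R * n%:R :> R by rewrite ler_wpM2l.
have h2 : eps / 2 * n%:R * n%:R <= d%:R * n%:R.
  by apply: ler_wpM2r; [exact: ltW | move: n_large large; lra].
have h3 : n%:R * x <= n%:R * (n%:R * (eps / 4)).
  by rewrite /x !ler_wpM2l ?(ltW n0).
have h4 : (1 / 2 + eps / 2) * (n%:R * x) <= 1 * (n%:R * x).
  apply: ler_wpM2r; last by move: eps1; lra.
  by apply: mulr_ge0; [exact: ltW | exact: le_trans x_ge1].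
by lra.
Qed.

Lemma Prob_rigid_le :
  Gnp_prob p (@d_rigid R d n) <= expR (- (eps ^+ 2 / 16 * n%:R)).
Proof.
case/andP: p01 => p0 p1.
set g := (1 / 2 + eps / 2) * (n%:R * (n%:R * p)).
rewrite Gnp_probE.
have s0 : 0 < 1 + eps / 2 by rewrite addr_gt0 // divr_gt0.
set s := eps / 2 in s0 *.
have s_gt0 : 0 < s by rewrite /s divr_gt0.
(* The Chernoff parameter [ln (1 + s)] with [s = eps / 2] tilts the mean, about [n ^ 2 * p / 2],
   part of the way to [g]. *)
have L_ge : s / (1 + s) <= ln (1 + s).
  rewrite -ler_expR lnK ?posrE //.
  have h := expR_ge1Dx (- (s / (1 + s))).
  have e : 1 - s / (1 + s) = (1 + s)^-1 by field; rewrite gt_eqF.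
  by rewrite e expRN lef_pV2 ?posrE ?expR_gt0 in h.
have L0 : 0 <= ln (1 + s) by apply: le_trans L_ge; rewrite divr_ge0 // ltW.
apply: le_trans (chernoff p01 (Y := all_pairs n) (L := ln (1 + s)) (y := g) _) _.
  move=> E Elt /asboolP rig; have [dn le_E] := d_rigid_card_ge Elt rig.
  rewrite ler_wpM2l // (setIidPl Elt) (le_trans (rank_deficit dn)) //.
  by rewrite ler_nat.
rewrite setIid lnK ?posrE // ler_expR.
have N_le : #|all_pairs n|%:R <= n%:R * n%:R / 2 :> R.
  rewrite ler_pdivlMr // mulrC -!natrM ler_nat card_all_pairs leq_mul2l leq_pred.
  by rewrite orbT.
have h1 : p * (1 + s - 1) * #|all_pairs n|%:R <= p * s * (n%:R * n%:R / 2).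
  by rewrite (addrC 1) addrK ler_wpM2l // mulr_ge0 // ltW.
have x0 : 0 <= n%:R * (n%:R * p) by rewrite !mulr_ge0.
have g0 : 0 <= g by rewrite mulr_ge0 // addr_ge0 // ltW // divr_gt0.
have h2 : s / (1 + s) * g <= ln (1 + s) * g by rewrite ler_wpM2r.
have h3 : eps ^+ 2 / 16 <= s / (1 + s) * (1 / 2 + eps / 2) - s / 2.
  have -> : s / (1 + s) * (1 / 2 + eps / 2) - s / 2 = eps ^+ 2 / 8 / (1 + s).
    by rewrite /s; field; rewrite gt_eqF // /s; have := eps0; lra.
  rewrite ler_pdivlMr //; have : 0 <= eps ^+ 2 by rewrite exprn_ge0 // ltW.
  by rewrite /s; have := eps1; nra.
have h4 := ler_wpM2r x0 h3.
have h5 : eps ^+ 2 / 16 * n%:R <= eps ^+ 2 / 16 * (n%:R * (n%:R * p)).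
  by rewrite ler_wpM2l ?ler_peMr // divr_ge0 // exprn_ge0 // ltW.
by move: h1 h2 h4 h5; rewrite /g; lra.
Qed.

End Flexible.

(** * Asymptotics *)

Section Asymptotics.
Variable R : realType.
Local Open Scope classical_set_scope.

Lemma near_ln_ge (K : R) : \forall n \near \oo, K <= ln n%:R.
Proof.
near=> n.
have Kn : expR K <= n%:R by near: n; exact: nbhs_infty_ger.
rewrite -[leLHS]expRK ler_ln ?posrE ?expR_gt0 //.
exact: lt_le_trans (expR_gt0 _) Kn.
Unshelve. all: by end_near. Qed.

Lemma expRN_le (c e x : R) : 0 < c -> 0 < e -> - ln e / c <= x ->
  expR (- (c * x)) <= e.
Proof.
move=> c0 e0; rewrite ler_pdivrMr // => h.
by rewrite -[leRHS]lnK ?posrE // ler_expR; lra.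
Qed.

End Asymptotics.

Local Open Scope classical_set_scope.

Theorem theoremB (R : realType) (p : nat -> R) :
  let Cstar : R := 2 / (1 - ln 2) in
  (\forall n \near \oo, Cstar * ln n%:R / n%:R <= p n) ->
  ((fun n => p n * Num.sqrt n%:R) @ \oo --> 0) ->
  forall eps : R, 0 < eps < 1 / 2 ->
  forall d : nat -> nat,
    ((\forall n \near \oo, (d n)%:R < (1 / 2 - eps) * n%:R * p n) ->
      (fun n => Gnp_prob (p n) (@d_rigid R (d n) n)) @ \oo --> (1 : R)) /\
    ((\forall n \near \oo, (d n)%:R > (1 / 2 + eps) * n%:R * p n) ->
      (fun n => Gnp_prob (p n) (@d_rigid R (d n) n)) @ \oo --> (0 : R)).
Proof.
move=> Cstar p_ge p_small eps /andP[eps0 eps1] d.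
have l1 := ln2_lt1 R; have l0 := ln2_gt0 R.
have C2 : 2 <= Cstar.
  rewrite -[leLHS]mulr1 ler_wpM2l // invf_ge1 ?subr_gt0 //.
  by rewrite gerBl ltW.
have np_ge : \forall n \near \oo, Cstar * ln n%:R <= n%:R * p n.
  near=> n; have n0 : 0 < n%:R :> R by rewrite ltr0n; near: n; exact: nbhs_infty_gt.
  by rewrite [leRHS]mulrC -ler_pdivrMr //; near: n.
have np_large (K : R) : \forall n \near \oo, K <= n%:R * p n.
  near=> n.
  have h : Cstar * ln n%:R <= n%:R * p n by near: n.
  have h0 : 0 <= ln n%:R :> R by near: n; exact: near_ln_ge.
  have h1 : K <= ln n%:R by near: n; exact: near_ln_ge.
  have := ler_wpM2r h0 C2; lra.
have p0 : \forall n \near \oo, 0 <= p n.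
  near=> n; have n0 : 0 < n%:R :> R by rewrite ltr0n; near: n; exact: nbhs_infty_gt.
  by rewrite -(pmulr_rge0 _ n0); near: n; exact: np_large.
(* The two forms in which the decay of [p] is used: the first makes [d] small against [n], the
   second [d ^ 2] small against [n]. *)
have sqrt_le (s : R) : 0 < s -> \forall n \near \oo,
    p n <= s /\ n%:R * p n ^+ 2 <= s ^+ 2.
  move=> s0; move/cvgr0Pnorm_le: (p_small) => /(_ s s0) small.
  near=> n.
  have pn0 : 0 <= p n by near: n.
  have n1 : 1 <= n%:R :> R by near: n; exact: nbhs_infty_ger.
  have q1 : 1 <= Num.sqrt n%:R :> R by rewrite -[leLHS]sqrtr1 ler_wsqrtr.
  have h : `|p n * Num.sqrt n%:R| <= s by near: n; exact: small.
  rewrite ger0_norm ?mulr_ge0 ?sqrtr_ge0 // in h.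
  split; first by apply: le_trans h; rewrite ler_peMr.
  have : (p n * Num.sqrt n%:R) ^+ 2 <= s ^+ 2.
    by rewrite lerXn2r ?nnegrE ?mulr_ge0 ?sqrtr_ge0 // ltW.
  by rewrite exprMn sqr_sqrtr ?ler0n // [n%:R * _]mulrC.
split=> d_bound; apply/cvgrPdist_le => e e0.
  pose eta : R := 2 * expR (- (8 / eps)).
  have eta0 : 0 < eta by rewrite mulr_gt0 // expR_gt0.
  have eta2 : eta <= 2.
    by rewrite /eta ler_piMr // expR_le1 oppr_le0 divr_ge0 // ltW.
  (* With D close to xi n, the error 4 D + d^2 n^2 / D^2 of rigidity_criterion is
     at most 6 xi n = eps eta n / 2. *)
  pose xi := eps * eta / 12.
  have xi0 : 0 < xi by rewrite divr_gt0 // mulr_gt0.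
  have xi1 : xi <= 1 / 12.
    have : eps * eta <= 1 / 2 * 2 by rewrite ler_pM // ltW.
    by rewrite /xi; lra.
  have e3 : 0 < e / 3 by rewrite divr_gt0.
  have e4 : 0 < e / 3 / expR 1 by rewrite divr_gt0 // expR_gt0.
  have el0 : 0 < eps * ln 2 by rewrite mulr_gt0.
  near=> n.
  have [p_xi p2_xi] : p n <= xi ^+ 2 /\ n%:R * p n ^+ 2 <= (xi ^+ 2) ^+ 2.
    by near: n; apply: sqrt_le; rewrite exprn_gt0.
  have pn0 : 0 <= p n by near: n.
  have n_ge : 4 / xi <= n%:R by near: n; exact: nbhs_infty_ger.
  have n0 : 0 < n%:R :> R by apply: lt_le_trans n_ge; rewrite divr_gt0.
  have xin : 4 <= xi * n%:R by rewrite mulrC -ler_pdivrMr.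
  have xi2 : xi ^+ 2 <= xi.
    by rewrite expr2 ler_piMr ?(ltW xi0) //; lra.
  have p01 : 0 <= p n <= 1 by rewrite pn0 (le_trans p_xi) // (le_trans xi2) //; lra.
  have d_lt : (d n)%:R < (1 / 2 - eps) * n%:R * p n by near: n.
  have np0 : 0 <= n%:R * p n by rewrite mulr_ge0 // ltW.
  have d_np : (d n)%:R <= n%:R * p n.
    apply: le_trans (ltW d_lt) _; rewrite -mulrA ler_piMl //; lra.
  have d_xi : (d n)%:R <= xi * n%:R.
    apply: le_trans d_np _; rewrite mulrC ler_wpM2r ?(ltW n0) //.
    exact: le_trans p_xi xi2.
  have d_lt_n : (d n < n)%N.
    rewrite -(ltr_nat R); apply: le_lt_trans d_xi _.
    by rewrite gtr_pMl //; lra.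
  have /andP[D_le D_gt] := truncn_itv (mulr_ge0 (ltW xi0) (ltW n0)).
  set D := (Num.truncn (xi * n%:R)).+1 in D_gt.
  have dD : (d n <= D)%N by rewrite -(ler_nat R) (le_trans d_xi) // ltW.
  have D_small : (4 * D + (d n ^ 2 * n ^ 2) %/ D ^ 2)%:R <= eps * eta / 2 * n%:R.
    (* From [d <= n * p] and [n * p ^ 2 <= xi ^ 4] the numerator is at most [xi ^ 4 * n ^ 3];
       dividing by [D ^ 2 >= xi ^ 2 * n ^ 2] leaves [xi ^ 2 * n]. *)
    have X_le : ((d n ^ 2 * n ^ 2) %/ D ^ 2)%:R <= xi * n%:R :> R.
      have D2 : 0 < (D ^ 2)%:R :> R by rewrite ltr0n expn_gt0.
      have h1 : ((d n ^ 2 * n ^ 2) %/ D ^ 2 * D ^ 2)%:R <= (d n ^ 2 * n ^ 2)%:R :> R.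
        by rewrite ler_nat leq_trunc_div.
      have h2 : (xi * n%:R) ^+ 2 <= (D ^ 2)%:R.
        rewrite natrX; apply: lerXn2r; rewrite ?nnegrE; last exact: ltW.
          by apply: mulr_ge0; exact: ltW.
        exact: ler0n.
      have h3 : (d n ^ 2 * n ^ 2)%:R <= n%:R * (xi ^+ 2) ^+ 2 * n%:R ^+ 2 :> R.
        rewrite natrM !natrX ler_wpM2r ?sqr_ge0 //.
        apply: le_trans (_ : (n%:R * p n) ^+ 2 <= _); first by rewrite lerXn2r ?nnegrE.
        by rewrite exprMn expr2 -mulrA ler_wpM2l // ltW.
      rewrite -(ler_pM2r D2) -natrM (le_trans h1) // (le_trans h3) //.
      apply: le_trans (ler_wpM2l (mulr_ge0 (ltW xi0) (ltW n0)) h2).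
      rewrite (_ : n%:R * _ * _ = xi * (xi * (xi ^+ 2 * n%:R ^+ 3))); last by ring.
      rewrite (_ : xi * n%:R * _ = xi * (xi ^+ 2 * n%:R ^+ 3)); last by ring.
      have y0 : 0 <= xi ^+ 2 * n%:R ^+ 3 by apply: mulr_ge0; apply: exprn_ge0; exact: ltW.
      by apply: ler_wpM2l; [exact: ltW | apply: ler_piMl => //; lra].
    rewrite natrD natrM /D -natr1.
    have -> : eps * eta / 2 * n%:R = 6 * (xi * n%:R) by rewrite /xi; field.
    by move: X_le D_le xin; rewrite /D; lra.
  have n_large : 4 <= eps * eta * n%:R by move: xin; rewrite /xi; lra.
  have np_large2 : 2 <= eps ^+ 2 * eta / 8 * (n%:R * p n).
    have c0 : 0 < eps ^+ 2 * eta / 8 by rewrite divr_gt0 // mulr_gt0 // exprn_gt0.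
    by rewrite [leRHS]mulrC -ler_pdivrMr //; near: n; exact: np_large.
  have npC : 2 / (1 - ln 2) * ln n%:R <= n%:R * p n by near: n.
  have rig := Prob_rigid_ge p01 d_lt_n eps0 eps1 (erefl eta) d_lt npC
    (ltn0Sn _) dD D_small n_large np_large2.
  have b1 : expR (- (eps * ln 2 * ln n%:R)) <= e / 3 / expR 1.
    by apply: expRN_le => //; near: n; exact: near_ln_ge.
  have b2 : 2 / n%:R <= e / 3.
    rewrite ler_pdivrMr // mulrC -ler_pdivrMr //.
    by near: n; exact: nbhs_infty_ger.
  have b3 : expR (- n%:R) <= e / 3.
    by rewrite -[n%:R]mul1r; apply: expRN_le => //; near: n; exact: nbhs_infty_ger.
  rewrite ler_pdivlMr ?expR_gt0 // mulrC in b1.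
  rewrite ger0_norm ?subr_ge0; last by rewrite Gnp_probE Prob_le1.
  by lra.
near=> n.
have pn0 : 0 <= p n by near: n.
have [p_eps _] : p n <= eps / 4 /\ n%:R * p n ^+ 2 <= (eps / 4) ^+ 2.
  by near: n; apply: sqrt_le; rewrite divr_gt0.
have p01 : 0 <= p n <= 1 by rewrite pn0 (le_trans p_eps) //; lra.
have d_gt : (1 / 2 + eps) * n%:R * p n < (d n)%:R by near: n.
have n_large : 2 <= eps * n%:R.
  by rewrite mulrC -ler_pdivrMr //; near: n; exact: nbhs_infty_ger.
have np1 : 1 <= n%:R * p n by near: n; exact: np_large.
have := Prob_rigid_le p01 eps0 eps1 d_gt n_large p_eps np1.
rewrite distrC subr0 ger0_norm; last by rewrite Gnp_probE Prob_ge0.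
move=> /le_trans; apply; apply: expRN_le => //.
  by rewrite divr_gt0 // exprn_gt0.
by near: n; exact: nbhs_infty_ger.
Unshelve. all: by end_near. Qed.
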